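(* Assume $V=L$. Then there exists a (lightface) $\Pi^1_1$ set $A\subseteq\omega^\omega$ such that $[H]\cap A\neq\emptyset$ for every Hechler tree $H$, but there is no Laver tree $L$ with $[L]\subseteq A$.
   Context: A subtree of $\omega^{<\omega}$ is a nonempty subset closed under initial segments; $sn$ denotes the one-term extension of $s$ by $n$. A subtree $H$ is Hechler iff for every $s\in H$, $sn\in H$ for all but finitely many $n$. A subtree $L$ is Laver iff for every $s\in L$, $sn\in L$ for infinitely many $n$. $[T]=\{x\in\omega^\omega:\forall n\ x\upharpoonright n\in T\}$. $V=L$ is Gödel's axiom of constructibility. *)

(* Defs.v *)
From mathcomp Require Import all_boot.
From mathcomp Require Import boolp classical_sets cardinality.

Set Implicit Arguments.
Unset Strict Implicit.
Unset Printing Implicit Defensive.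

Local Open Scope classical_set_scope.

Definition scons (T : Type) (a : T) (e : nat -> T) : nat -> T :=
  fun k => if k is k'.+1 then e k' else a.

(* The cumulative hierarchy as a W-type (Aczel): [VSet f] is the set whose
   elements are the [f a]. Together with [Veq] and [Vin] it is a model of ZFC
   under classical logic and choice. *)
Inductive V : Type := VSet (A : Type) (f : A -> V).

Definition Vidx (x : V) : Type := let: VSet A _ := x in A.
Definition Velt (x : V) : Vidx x -> V :=
  match x return Vidx x -> V with VSet _ f => f end.

Fixpoint Veq (x y : V) {struct x} : Prop :=
  match x, y with
  | VSet A f, VSet B g =>
      (forall a, exists b, Veq (f a) (g b)) /\
      (forall b, exists a, Veq (f a) (g b))
  end.

Definition Vin (x y : V) : Prop := exists b : Vidx y, Veq x (Velt b).

Definition Vtransitive (x : V) : Prop :=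
  forall y z, Vin z y -> Vin y x -> Vin z x.

Definition Vordinal (x : V) : Prop :=
  Vtransitive x /\ (forall y, Vin y x -> Vtransitive y).

Definition Vbigcup (A : Type) (F : A -> V) : V :=
  VSet (fun p : {a : A & Vidx (F a)} => Velt (projT2 p)).

(* First-order formulas in the language {=, ∈}, with de Bruijn indices. *)
Inductive sfml : Type :=
  | SEq of nat & nat
  | SIn of nat & nat
  | SBot
  | SImp of sfml & sfml
  | SAll of sfml.

(* Satisfaction in the structure (x, ∈), whose elements are named by the
   indices of [x]. *)
Fixpoint ssat (x : V) (e : nat -> Vidx x) (phi : sfml) : Prop :=
  match phi with
  | SEq i j => Veq (Velt (e i)) (Velt (e j))
  | SIn i j => Vin (Velt (e i)) (Velt (e j))
  | SBot => False
  | SImp p q => ssat e p -> ssat e q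
  | SAll p => forall a : Vidx x, ssat (scons a e) p
  end.

(* Def(x): the subsets {y ∈ x | (x, ∈) ⊨ phi(y, p_1, ..., p_n)}. Variable 0
   denotes y and variable i denotes p_i for 1 <= i <= n; variables beyond n also
   denote y, so that the empty list of parameters is allowed and Def(∅) = {∅}. *)
Definition Vdef (x : V) : V :=
  VSet (fun q : sfml * seq (Vidx x) =>
    VSet (fun y : {a : Vidx x | ssat (fun k => nth a (a :: q.2) k) q.1} =>
      Velt (sval y))).

(* L_α = ⋃_{β ∈ α} Def(L_β), so L_0 = ∅, L_{α+1} = Def(L_α), and unions are
   taken at limits. *)
Fixpoint Lstage (x : V) : V :=
  let: VSet A f := x in Vbigcup (fun a : A => Vdef (Lstage (f a))).

Definition V_eq_L : Prop :=
  forall x : V, exists alpha : V, Vordinal alpha /\ Vin x (Lstage alpha).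

(* Parameter-free arithmetical formulas about two elements of ω^ω: number
   variables are de Bruijn indices, and [AFun1], [AFun2] apply the first and the
   second function variable. *)
Inductive aterm : Type :=
  | AVar of nat
  | AZero
  | ASucc of aterm
  | AAdd of aterm & aterm
  | AMul of aterm & aterm
  | AFun1 of aterm
  | AFun2 of aterm.

Inductive afml : Type :=
  | AEq of aterm & aterm
  | ABot
  | AImp of afml & afml
  | AAll of afml.

Fixpoint aval (x y : nat -> nat) (e : nat -> nat) (t : aterm) : nat :=
  match t with
  | AVar i => e i
  | AZero => 0
  | ASucc t => (aval x y e t).+1
  | AAdd t u => aval x y e t + aval x y e u
  | AMul t u => aval x y e t * aval x y e u
  | AFun1 t => x (aval x y e t)
  | AFun2 t => y (aval x y e t)
  end.

Fixpoint asat (x y : nat -> nat) (e : nat -> nat) (phi : afml) : Prop :=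
  match phi with
  | AEq t u => aval x y e t = aval x y e u
  | ABot => False
  | AImp p q => asat x y e p -> asat x y e q
  | AAll p => forall n : nat, asat x y (scons n e) p
  end.

(* A = {x | ∀ y ∈ ω^ω, θ(x, y)} with θ arithmetical. Unbound number variables
   of θ denote 0. *)
Definition lightface_Pi11 (A : set (nat -> nat)) : Prop :=
  exists theta : afml,
    forall x, A x <-> forall y : nat -> nat, asat x y (fun=> 0) theta.

Definition subtree (T : set (seq nat)) : Prop :=
  T !=set0 /\ forall s t, prefix s t -> T t -> T s.

Definition hechler (H : set (seq nat)) : Prop :=
  subtree H /\ forall s, H s -> finite_set [set n | ~ H (rcons s n)].

Definition laver (L : set (seq nat)) : Prop :=
  subtree L /\ forall s, L s -> infinite_set [set n | L (rcons s n)].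

(* [T]; [mkseq x n] is x ↾ n. *)
Definition branches (T : set (seq nat)) : set (nat -> nat) :=
  [set x | forall n, T (mkseq x n)].

(* Main.v *)
(* A real [x] codes by the parities of its values a relation [Er x] on the natural
   numbers. Let [A] be the set of all [x] such that [Er x] is well-founded and some
   function in the levels of L along the collapse of [Er x] is not eventually
   dominated by [x]. Truth in these levels is the unique solution of arithmetical
   (Tarskian) clauses over codes of names, so [A] is Pi^1_1.

   Given a Hechler tree [H], there is a single [h] such that every set of natural
   numbers is the parity of some [x] in [[H]] with [x <= h]. By V = L and a
   Löwenheim-Skolem argument on names, [h + 1] lies in a level along some
   well-founded relation on the natural numbers; let [x] code that relation.

   If [[L]] is included in [A], then, by the Kunen-Martin argument, the ranks of
   the [Er x] for [x] in [[L]] are bounded by that of a single countable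
   well-founded relation. So only countably many functions are relevant, and a
   Laver tree has a branch that dominates all of them. *)

Require Import Defs.
From mathcomp Require Import all_boot.
From mathcomp Require Import boolp classical_sets cardinality.
From mathcomp Require Import zify.

Set Implicit Arguments.
Unset Strict Implicit.
Unset Printing Implicit Defensive.

Local Open Scope classical_set_scope.

(** * Sets and the constructible hierarchy *)

Lemma Veq_refl x : Veq x x.
Proof. by elim: x => A f IH; split=> a; exists a. Qed.

Lemma Veq_sym x y : Veq x y -> Veq y x.
Proof.
elim: x y => A f IH [B g] [H1 H2]; split=> [b|a].
  by have [a Ha] := H2 b; exists a; apply: IH.
by have [b Hb] := H1 a; exists b; apply: IH.
Qed.

Lemma Veq_trans y x z : Veq x y -> Veq y z -> Veq x z.
Proof.
elim: x y z => A f IH [B g] [C h] [H1 H2] [H3 H4]; split=> [a|d].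
  by have [b Hb] := H1 a; have [d Hd] := H3 b; exists d; apply: IH Hb Hd.
by have [b Hb] := H4 d; have [a Ha] := H2 b; exists a; apply: IH Ha Hb.
Qed.

Lemma Velt_in x (a : Vidx x) : Vin (Velt a) x.
Proof. by exists a; apply: Veq_refl. Qed.

Lemma Vin_eql x x' y : Veq x x' -> Vin x y -> Vin x' y.
Proof. by move=> E [b Hb]; exists b; apply: Veq_trans Hb; apply: Veq_sym. Qed.

Lemma VeqP x y : Veq x y <-> forall v, Vin v x <-> Vin v y.
Proof.
case: x y => [A f] [B g]; split=> [[H1 H2] v|H].
  split=> -[/= a Ha].
    by have [b Hb] := H1 a; exists b; apply: Veq_trans Hb.
  by have [b Hb] := H2 a; exists b; apply: Veq_trans (Veq_sym Hb).
split=> [a|b].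
  by have [b /= Hb] := (H (f a)).1 (@Velt_in (VSet f) a); exists b.
have [a /= Ha] := (H (g b)).2 (@Velt_in (VSet g) b).
by exists a; apply: Veq_sym.
Qed.

Lemma Vin_eqr x y y' : Veq y y' -> Vin x y -> Vin x y'.
Proof. by move=> /VeqP/(_ x)[]. Qed.

Lemma Vin_congr x x' y y' : Veq x x' -> Veq y y' -> Vin x y <-> Vin x' y'.
Proof.
move=> Ex Ey; split=> H.
  exact: Vin_eql Ex (Vin_eqr Ey H).
exact: Vin_eql (Veq_sym Ex) (Vin_eqr (Veq_sym Ey) H).
Qed.

Lemma Veq_congr x x' y y' : Veq x x' -> Veq y y' -> Veq x y <-> Veq x' y'.
Proof.
move=> Ex Ey; split=> H.
  by apply: Veq_trans (Veq_trans (Veq_sym Ex) H) Ey.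
by apply: Veq_trans (Veq_trans Ex H) (Veq_sym Ey).
Qed.

(** Members of a set are only [Veq] to its branches, so the structural induction runs on the claim
    for all sets [Veq] to [x]. *)
Lemma Vin_ind (P : V -> Prop) :
  (forall x, (forall y, Vin y x -> P y) -> P x) -> forall x, P x.
Proof.
move=> IH x; suff: forall y, Veq y x -> P y by apply; apply: Veq_refl.
elim: x => A f IHf y Ey; apply: IH => z /(Vin_eqr Ey)[a]; exact: IHf.
Qed.

Definition Vsep (x : V) (P : V -> Prop) : V :=
  VSet (fun a : {a : Vidx x | P (Velt a)} => Velt (sval a)).

Lemma Vin_sep x P v : (forall w w', Veq w w' -> P w -> P w') ->
  Vin v (Vsep x P) <-> Vin v x /\ P v.
Proof.
move=> HP; split=> [[[a Pa] /= Ea]|[[a Ea] Pv]].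
  by split; [exists a | apply: HP Pa; apply: Veq_sym].
by exists (exist _ a (HP _ _ Ea Pv)).
Qed.

(* [ssat] with environments in [V] instead of index types; unlike [ssat], it is
   visibly invariant under [Veq]. *)
Fixpoint Vsat (x : V) (e : nat -> V) (phi : sfml) : Prop :=
  match phi with
  | SEq i j => Veq (e i) (e j)
  | SIn i j => Vin (e i) (e j)
  | SBot => False
  | SImp p q => Vsat x e p -> Vsat x e q
  | SAll p => forall v, Vin v x -> Vsat x (scons v e) p
  end.

Lemma Vsat_congr x x' phi e e' : Veq x x' -> (forall k, Veq (e k) (e' k)) ->
  Vsat x e phi <-> Vsat x' e' phi.
Proof.
move=> Ex; elim: phi e e' => [i j|i j||p IHp q IHq|p IHp] e e' Ee /=.
- exact: Veq_congr.
- exact: Vin_congr.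
- by [].
- by have := IHp _ _ Ee; have := IHq _ _ Ee; tauto.
- have Es v k : Veq (scons v e k) (scons v e' k).
    by case: k => [|k] /=; [apply: Veq_refl | apply: Ee].
  split=> H v Hv.
    by apply/(IHp _ _ (Es v))/H/(Vin_eqr (Veq_sym Ex)).
  by apply/(IHp _ _ (Es v))/H/(Vin_eqr Ex).
Qed.

Lemma ssatE x (e : nat -> Vidx x) phi :
  ssat e phi <-> Vsat x (fun k => Velt (e k)) phi.
Proof.
elim: phi e => [i j|i j||p IHp q IHq|p IHp] e //=.
  by have := IHp e; have := IHq e; tauto.
have Es a k : scons (Velt a) (fun k => Velt (e k)) k = Velt (scons a e k).
  by case: k.
split=> H.
  move=> v [a Ea]; have := H a; rewrite IHp; apply: (Vsat_congr _ _ _).1.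
    exact: Veq_refl.
  by case=> [|k] /=; [apply: Veq_sym | apply: Veq_refl].
move=> a; rewrite IHp; apply: (Vsat_congr _ _ _).1 (H _ (Velt_in a)).
  exact: Veq_refl.
by move=> k; rewrite Es; apply: Veq_refl.
Qed.

(** The default of [nth] is part of the environment: as in [Vdef], variables beyond the parameters
    denote the candidate element. *)
Lemma Vsat_nth_congr x (ps ps' : seq V) v v' phi :
  size ps = size ps' -> (forall i, i < size ps -> Veq (nth v ps i) (nth v ps' i)) ->
  Veq v v' ->
  Vsat x (nth v ps) phi -> Vsat x (nth v' ps') phi.
Proof.
move=> Es Eps Ev; apply: (Vsat_congr _ _ _).1; first exact: Veq_refl.
move=> k; case: (ltnP k (size ps)) => Hk.
  by rewrite (set_nth_default v v') -?Es //; apply: Eps.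
by rewrite !nth_default // -Es.
Qed.

(** Parameters become sets instead of indices, which makes invariance of Def under [Veq]
    accessible. *)
Lemma Vin_Vdef z x : Vin z (Vdef x) <->
  exists phi (ps : seq V), (forall i, i < size ps -> Vin (nth x ps i) x) /\
    forall v, Vin v z <-> Vin v x /\ Vsat x (nth v (v :: ps)) phi.
Proof.
pose D phi ps v := Vsat x (nth v (v :: ps)) phi.
have DE phi ps w w' : Veq w w' -> D phi ps w -> D phi ps w'.
  move=> Ew; apply: Vsat_nth_congr => // -[|i] _ //=; exact: Veq_refl.
have satE phi (qs : seq (Vidx x)) a :
    ssat (fun k => nth a (a :: qs) k) phi <-> D phi (map (@Velt x) qs) (Velt a).
  rewrite ssatE /D -map_cons; apply: Vsat_congr; first exact: Veq_refl.
  move=> k; case: (ltnP k (size (a :: qs))) => Hk.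
    by rewrite (nth_map a) //; apply: Veq_refl.
  by rewrite !nth_default ?size_map //; apply: Veq_refl.
split=> [[[phi qs] /= Ez]|[phi [ps [Hps Hz]]]].
  exists phi, (map (@Velt x) qs); split.
    case: qs {Ez} => [|b qs] // i; rewrite size_map => Hi.
    by rewrite (nth_map b) //; apply: Velt_in.
  move=> v; have /VeqP/(_ v) -> := Ez; split.
    move=> [[a /= Ha] /= Ev]; split; first by exists a.
    by apply: DE (Veq_sym Ev) _; apply/satE.
  move=> [[a Ea] Dv]; have Ha := (satE phi qs a).2 (DE _ _ _ _ Ea Dv).
  by exists (exist _ a Ha).
have [qs Eqs Hqs] : exists2 qs : seq (Vidx x), size qs = size ps &
    forall v i, i < size ps -> Veq (nth v ps i) (nth v (map (@Velt x) qs) i).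
  elim: ps Hps {Hz} => [|p ps IH] Hps; first by exists [::].
  have [a Ea] := Hps 0 isT.
  have [|qs Eqs Hqs] := IH; first by move=> i Hi; apply: (Hps i.+1).
  exists (a :: qs); first by rewrite /= Eqs.
  by move=> v [|i] //= Hi; apply: Hqs.
exists (phi, qs) => /=; apply/VeqP => v; rewrite Hz.
have DD w : D phi ps w <-> D phi (map (@Velt x) qs) w.
  split; apply: Vsat_nth_congr; rewrite /= ?size_map ?Eqs //; try exact: Veq_refl.
    by case=> [|i] /= Hi; [apply: Veq_refl | apply: Hqs].
  by case=> [|i] /= Hi; [apply: Veq_refl | apply/Veq_sym/Hqs].
split.
  move=> [[a Ea] /DD Dv]; have Ha := (satE phi qs a).2 (DE _ _ _ _ Ea Dv).
  by exists (exist _ a Ha).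
move=> [[a /= Ha] /= Ev]; split; first by exists a.
by apply/DD; apply: DE (Veq_sym Ev) _; apply/satE.
Qed.

Lemma Vdef_eq x x' : Veq x x' -> forall z, Vin z (Vdef x) -> Vin z (Vdef x').
Proof.
move=> Ex z /Vin_Vdef[phi [ps [Hps Hz]]]; apply/Vin_Vdef.
exists phi, ps; split=> [i Hi|v].
  by rewrite (set_nth_default x) //; apply: Vin_eqr Ex (Hps i Hi).
rewrite Hz.
have E1 : Vin v x <-> Vin v x' by apply: Vin_congr => //; apply: Veq_refl.
have E2 : Vsat x (nth v (v :: ps)) phi <-> Vsat x' (nth v (v :: ps)) phi.
  by apply: Vsat_congr => // k; apply: Veq_refl.
by tauto.
Qed.

Lemma Vin_Lstage z x :
  Vin z (Lstage x) <-> exists a : Vidx x, Vin z (Vdef (Lstage (Velt a))).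
Proof.
case: x => A f; split=> [[[a b] /= Hb]|[a [b Hb]]].
  by exists a; exists b.
by exists (existT _ a b).
Qed.

Lemma Lstage_eq x x' : Veq x x' -> Veq (Lstage x) (Lstage x').
Proof.
elim: x x' => A f IH [B g] [H1 H2]; apply/VeqP => z; rewrite !Vin_Lstage.
split=> -[a Ha].
  by have [b Hb] := H1 a; exists b; apply: Vdef_eq Ha; apply: IH.
have [b Hb] := H2 a; exists b; apply: Vdef_eq Ha.
by apply/Veq_sym/IH.
Qed.

Lemma Vin_LstageP z x :
  Vin z (Lstage x) <-> exists2 y, Vin y x & Vin z (Vdef (Lstage y)).
Proof.
rewrite Vin_Lstage; split=> [[a Ha]|[y [a Ea] Hz]].
  by exists (Velt a) => //; apply: Velt_in.
by exists a; apply: Vdef_eq Hz; apply: Lstage_eq.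
Qed.

(* [rle x y]: the rank of [x] is at most the rank of [y]. *)
Fixpoint rle (x y : V) {struct x} : Prop :=
  let: VSet A f := x in forall a : A, exists b : Vidx y, rle (f a) (Velt b).

Lemma rleE x y :
  rle x y <-> forall a : Vidx x, exists b : Vidx y, rle (Velt a) (Velt b).
Proof. by case: x. Qed.

Lemma Veq_rle x y : Veq x y -> rle x y.
Proof.
by elim: x y => A f IH [B g] [H _] a; have [b /IH Hb] := H a; exists b.
Qed.

Lemma rle_trans y x z : rle x y -> rle y z -> rle x z.
Proof.
elim: x y z => A f IH y z /rleE H1 /rleE H2; apply/rleE => a.
have [b Hb] := H1 a; have [c Hc] := H2 b.
by exists c; apply: IH Hb Hc.
Qed.

Lemma rleP x y :
  rle x y <-> forall a, Vin a x -> exists2 b, Vin b y & rle a b.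
Proof.
rewrite rleE; split=> [H a [i Ei]|H a].
  have [b Hb] := H i; exists (Velt b); first exact: Velt_in.
  exact: rle_trans (Veq_rle Ei) Hb.
have [b [i Ei] Hb] := H _ (Velt_in a).
by exists i; apply: rle_trans Hb (Veq_rle Ei).
Qed.

Lemma Vin_rle x y : Vin x y -> rle x y.
Proof.
elim/Vin_ind: x y => x IH y Hxy; apply/rleP => a Ha; exists x => //.
exact: IH.
Qed.

(** A member [a] of [x] that violates [rle x y] outranks every member of [y], by the induction
    hypothesis for [a]. *)
Lemma rle_total x y : ~ rle x y -> exists2 a, Vin a x & rle y a.
Proof.
elim/Vin_ind: x y => x IH y; rewrite rleP => /existsNP[a /not_implyP[Ha Hn]].
exists a => //; apply/rleP => b Hb.
have [|a' Ha' Hba'] := IH a Ha b; last by exists a'.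
by move=> Hab; apply: Hn; exists b.
Qed.

(** Induction on rank: the hypothesis covers every set whose rank is at most that of a member of
    [y], not only the members. *)
Lemma rank_ind (P : V -> Prop) :
  (forall y, (forall b y', Vin b y -> rle y' b -> P y') -> P y) -> forall y, P y.
Proof.
move=> IH y; suff: forall y', rle y' y -> P y' by apply; apply/Veq_rle/Veq_refl.
elim/Vin_ind: y => y IHy y' Hy'; apply: IH => b y'' Hb Hy''.
have [d Hd Hbd] := (rleP _ _).1 Hy' _ Hb.
exact: IHy Hd _ (rle_trans Hy'' Hbd).
Qed.

(** Stages are indexed by arbitrary sets and depend only on rank. If the ranks agree, the two stages
    are equal; otherwise some [b] in [y] bounds [x], and induction puts [z] into Def(L_b), hence
    into L_y. *)
Lemma Vdef_Lstage_rle x y : rle x y ->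
  forall z, Vin z (Vdef (Lstage x)) -> Vin z (Vdef (Lstage y)).
Proof.
elim/rank_ind: y x => y IH x Hxy z Hz.
have [Hyx|/rle_total[b Hb Hxb]] := pselect (rle y x).
  apply: Vdef_eq Hz; apply/VeqP => w; rewrite !Vin_LstageP; split.
    move=> [x' Hx' Hw]; have [y' Hy' Hxy'] := (rleP _ _).1 Hxy _ Hx'.
    exists y' => //; apply: (IH y' y' Hy' _ x' Hxy' _ Hw).
    exact/Veq_rle/Veq_refl.
  move=> [y' Hy' Hw]; have [x' Hx' Hyx'] := (rleP _ _).1 Hyx _ Hy'.
  have [y'' Hy'' Hxy''] := (rleP _ _).1 Hxy _ Hx'.
  by exists x' => //; apply: (IH y'' x' Hy'' Hxy'' y').
have rbb : rle b b by apply/Veq_rle/Veq_refl.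
have Hzb := IH b b Hb rbb x Hxb _ Hz.
have sub w : Vin w z -> Vin w (Lstage y).
  move=> Hw; have /Vin_Vdef[phi [ps [_ /(_ w)]]] := Hzb.
  move=> [/(_ Hw) [/Vin_LstageP[b' Hb' Hw'] _] _].
  apply/Vin_LstageP; exists b => //.
  by apply: (IH b b Hb rbb b') => //; apply: Vin_rle.
(* As [z] is both an element and a subset of L_y, it is defined over L_y by membership in the
   parameter [z]. *)
apply/Vin_Vdef; exists (SIn 0 1), [:: z]; split.
  by case=> // _ /=; apply/Vin_LstageP; exists b.
by move=> v /=; split=> [Hv|[]//]; split=> //; apply: sub.
Qed.

Lemma Lstage_rle x y z : rle x y -> Vin z (Lstage x) -> Vin z (Lstage y).
Proof.
move=> /rleP Hxy /Vin_LstageP[x' /Hxy[y' Hy' Hxy'] Hz].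
by apply/Vin_LstageP; exists y' => //; apply: Vdef_Lstage_rle Hz.
Qed.

(** * Names of constructible sets *)

(* Lists of names: [NCons p f ps r] is the name [Name p f ps] followed by [r].
   With a collapse [c], [Name p f ps] denotes the subset of L_{c p} defined by [f]
   with parameters [ps]. *)
Inductive nlist (X : Type) : Type :=
  | NNil
  | NCons of X & sfml & nlist X & nlist X.
Arguments NNil {X}.

Record name (X : Type) : Type :=
  Name { nlevel : X; nfml : sfml; nparams : nlist X }.

Definition ncons (X : Type) (a : name X) (l : nlist X) : nlist X :=
  NCons (nlevel a) (nfml a) (nparams a) l.

Fixpoint nnth (X : Type) (d : name X) (l : nlist X) (k : nat) : name X :=
  match l with
  | NNil => d
  | NCons p f ps r => if k is k'.+1 then nnth d r k' else Name p f ps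
  end.

Section Denotation.

Variables (X : Type) (E : X -> X -> Prop) (c : X -> V).

(** Hereditary well-formedness: a parameter of a name of level [m] has to denote an element of L_{c
    m}, so its own level lies [E]-below [m]. *)
Fixpoint okl (m : X) (l : nlist X) : Prop :=
  match l with
  | NNil => True
  | NCons p _ ps r => [/\ E p m, okl p ps & okl m r]
  end.

Definition valid (a : name X) : Prop := okl (nlevel a) (nparams a).
Definition ok (m : X) (a : name X) : Prop := E (nlevel a) m /\ valid a.

Lemma okl_cons m a l : okl m (ncons a l) <-> ok m a /\ okl m l.
Proof. by rewrite /ok /valid /=; split=> [[]|[[]]]. Qed.

Lemma ok_valid m a : ok m a -> valid a.
Proof. by case. Qed.

Lemma ok_nnth m d l k : ok m d -> okl m l -> ok m (nnth d l k).
Proof.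
move=> Hd; elim: l k => //= p f ps _ r IH [|k] [Epm Hps Hr] //.
exact: IH.
Qed.

(** The denotation of a name is inlined so that the recursion is structural on [nlist]; positions
    beyond the list denote [v], as in [Vdef]. *)
Fixpoint dnth (l : nlist X) (v : V) (k : nat) : V :=
  match l with
  | NNil => v
  | NCons p f ps r =>
      if k is k'.+1 then dnth r v k'
      else Vsep (Lstage (c p)) (fun w => Vsat (Lstage (c p)) (scons w (dnth ps w)) f)
  end.

Definition den (a : name X) : V :=
  Vsep (Lstage (c (nlevel a)))
    (fun w => Vsat (Lstage (c (nlevel a))) (scons w (dnth (nparams a) w)) (nfml a)).

Lemma den_nnth d l k : den (nnth d l k) = dnth l (den d) k.
Proof. by elim: l k => [|p f ps _ r IH] [|k] /=. Qed.

Lemma dnth_congr l v v' k : Veq v v' -> Veq (dnth l v k) (dnth l v' k).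
Proof.
move=> Ev; elim: l k => [|p f ps _ r IH] [|k] //; last exact: IH.
exact: Veq_refl.
Qed.

Lemma Vin_den v a : Vin v (den a) <-> Vin v (Lstage (c (nlevel a))) /\
  Vsat (Lstage (c (nlevel a))) (scons v (dnth (nparams a) v)) (nfml a).
Proof.
apply: Vin_sep => w w' Ew; apply: (Vsat_congr _ _ _).1; first exact: Veq_refl.
by case=> [|k] //=; apply: dnth_congr.
Qed.

Definition tru (m : X) (f : sfml) (d : name X) (l : nlist X) : Prop :=
  Vsat (Lstage (c m)) (dnth l (den d)) f.

(* [mem S b a]: [b] is one of the names that make up the set named by [a],
   according to the truth predicate [S]. *)
Definition mem (S : X -> sfml -> name X -> nlist X -> Prop) (b a : name X) : Prop :=
  ok (nlevel a) b /\ S (nlevel a) (nfml a) b (ncons b (nparams a)).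

(** Tarski's truth definition for all levels at once, with names in place of elements. Equality of
    names is extensional, so no set is mentioned and the clauses can be restated for codes. *)
Record clauses (S : X -> sfml -> name X -> nlist X -> Prop)
    (Q : name X -> name X -> Prop) : Prop := Clauses {
  clEq : forall m i j d l, ok m d -> okl m l ->
    S m (SEq i j) d l <-> Q (nnth d l i) (nnth d l j);
  clIn : forall m i j d l, ok m d -> okl m l ->
    S m (SIn i j) d l <-> exists2 b, mem S b (nnth d l j) & Q (nnth d l i) b;
  clBot : forall m d l, ok m d -> okl m l -> ~ S m SBot d l;
  clImp : forall m f g d l, ok m d -> okl m l ->
    S m (SImp f g) d l <-> (S m f d l -> S m g d l);
  clAll : forall m f d l, ok m d -> okl m l ->
    S m (SAll f) d l <-> forall a, ok m a -> S m f d (ncons a l);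
  clExt : forall a b, valid a -> valid b ->
    Q a b <-> (forall a', mem S a' a -> exists2 b', mem S b' b & Q a' b') /\
              (forall b', mem S b' b -> exists2 a', mem S a' a & Q a' b') }.

(** The Mostowski collapse up to [Veq]. The values need not be ordinals; for [Lstage] only their
    ranks matter. *)
Definition collapses : Prop :=
  forall q v, Vin v (c q) <-> exists2 p, E p q & Veq v (c p).

Hypothesis wfE : well_founded E.
Hypothesis Hc : collapses.

Fixpoint dseq (l : nlist X) : seq V :=
  if l is NCons p f ps r then den (Name p f ps) :: dseq r else [::].

Lemma nth_dseq v l k : nth v (v :: dseq l) k = scons v (dnth l v) k.
Proof. by case: k => //= k; elim: l k => [|p f ps _ r IH] [|k] //=. Qed.

(** By induction along [E]: a set definable over L_{c p} has parameters in L_{c p}, which already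
    have names, and these assemble into a name of level [p]. *)
Lemma Lstage_names m v :
  Vin v (Lstage (c m)) <-> exists2 a, ok m a & Veq v (den a).
Proof.
elim/(well_founded_ind wfE): m v => m IH v.
have satE p f l w : Vsat (Lstage (c p)) (nth w (w :: dseq l)) f <->
    Vsat (Lstage (c p)) (scons w (dnth l w)) f.
  apply: Vsat_congr => [|k]; rewrite ?nth_dseq; exact: Veq_refl.
split.
  move=> /Vin_LstageP[y /Hc[p Epm Ey] /(Vdef_eq (Lstage_eq Ey))].
  move=> /Vin_Vdef[f [ps [Hps Hv]]].
  have [l Hl [Esz El]] : exists2 l, okl p l & size ps = size (dseq l) /\
      forall w i, i < size ps -> Veq (nth w ps i) (nth w (dseq l) i).
    elim: ps Hps {Hv} => [|q ps IHps] Hps; first by exists NNil.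
    have [a Ha Ea] := (IH p Epm _).1 (Hps 0 isT).
    have [|l Hl [Esz El]] := IHps; first by move=> i Hi; apply: (Hps i.+1).
    exists (ncons a l); first exact/okl_cons.
    split=> [|w [|i] Hi] /=; first by rewrite Esz.
      by case: a Ea {Ha}.
    exact: El.
  exists (Name p f l) => //; apply/VeqP => w; rewrite Vin_den Hv /= -satE.
  suff: Vsat (Lstage (c p)) (nth w (w :: ps)) f <->
        Vsat (Lstage (c p)) (nth w (w :: dseq l)) f by tauto.
  split; apply: Vsat_nth_congr => /=; rewrite ?Esz //; try exact: Veq_refl.
    by case=> [|i] Hi /=; [apply: Veq_refl | apply: El; rewrite Esz].
  by case=> [|i] Hi /=; [apply: Veq_refl | apply/Veq_sym/El; rewrite Esz].
move=> [a [Eam Ha] Ea]; apply: Vin_eql (Veq_sym Ea) _.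
apply/Vin_LstageP; exists (c (nlevel a)).
  by apply/Hc; exists (nlevel a) => //; apply: Veq_refl.
apply/Vin_Vdef; exists (nfml a), (dseq (nparams a)); split.
  move: Ha; rewrite /valid; elim: (nparams a) => //= p f ps _ r IHr [Epa Hps Hr].
  case=> [|i] Hi /=; last exact: IHr.
  by apply/(IH _ Eam); exists (Name p f ps) => //; apply: Veq_refl.
by move=> w; rewrite Vin_den satE.
Qed.

Lemma mem_tru v a : Vin v (den a) <-> exists2 b, mem tru b a & Veq v (den b).
Proof.
have satE b w : Veq w (den b) ->
    Vsat (Lstage (c (nlevel a))) (scons w (dnth (nparams a) w)) (nfml a) <->
    tru (nlevel a) (nfml a) b (ncons b (nparams a)).
  move=> Eb; apply: Vsat_congr => [|[|k]] //=; first exact: Veq_refl.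
  exact: dnth_congr.
rewrite Vin_den Lstage_names; split=> [[[b Hb Eb] Hv]|[b [Hb Sb] Eb]].
  by exists b => //; split=> //; apply/(satE _ _ Eb).
by split; [exists b | apply/(satE _ _ Eb)].
Qed.

Lemma tru_clauses : clauses tru (fun a b => Veq (den a) (den b)).
Proof.
split=> [m i j d l _ _|m i j d l _ _|m d l _ _ []|
  m f g d l _ _|m f d l _ _|a b _ _].
- by rewrite !den_nnth.
- by rewrite /tru /= -!den_nnth mem_tru.
- by [].
- rewrite /tru /=; split=> H.
    move=> a Ha; have {}H : Vsat (Lstage (c m)) (scons (den a) (dnth l (den d))) f.
      by apply/H/Lstage_names; exists a => //; apply: Veq_refl.
    apply: (Vsat_congr _ _ _).1 H => [|[|k]]; exact: Veq_refl.
  move=> v /Lstage_names[a Ha Ea]; apply: (Vsat_congr _ _ _).1 (H a Ha).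
    exact: Veq_refl.
  by case=> [|k]; [apply: Veq_sym | apply: Veq_refl].
- rewrite VeqP; split=> [H|[H1 H2] v].
    split=> [a' Ma|b' Mb].
      by apply/mem_tru/H/mem_tru; exists a' => //; apply: Veq_refl.
    have [|a' Ma Ea] := (mem_tru (den b') a).1.
      by apply/H/mem_tru; exists b' => //; apply: Veq_refl.
    by exists a' => //; apply: Veq_sym.
  rewrite !mem_tru; split=> -[w Mw Ew].
    by have [b' Mb Eb] := H1 w Mw; exists b' => //; apply: Veq_trans Eb.
  have [a' Ma Ea] := H2 w Mw; exists a' => //.
  by apply: Veq_trans Ew _; apply: Veq_sym.
Qed.

(** Truth at a level reduces, by induction on formulas, to equality of names of lower levels.
    Extensionality reduces that equality to truth at those levels and to equality of members, whose
    levels are lower still. *)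
Lemma clauses_unique S Q : clauses S Q ->
  (forall m f d l, ok m d -> okl m l -> S m f d l <-> tru m f d l) /\
  (forall a b, valid a -> valid b -> Q a b <-> Veq (den a) (den b)).
Proof.
move=> HS; have HT := tru_clauses.
pose P m := forall f d l, ok m d -> okl m l -> S m f d l <-> tru m f d l.
have memE a b : P (nlevel a) -> valid a -> mem S b a <-> mem tru b a.
  move=> Pa Ha; rewrite /mem; split=> -[Hb H]; split=> //.
    by apply/Pa => //; apply/okl_cons.
  by apply/Pa => //; apply/okl_cons.
pose R p q := forall a b, nlevel a = p -> nlevel b = q -> valid a -> valid b ->
  Q a b <-> Veq (den a) (den b).
(* Equality of two names only depends on truth at levels hereditarily below
   theirs, and [E] need not be transitive. *)
pose below m := forall p, Relation_Operators.clos_refl_trans_1n X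
  (fun q p => E p q) m p -> P p.
have belowE m p : E p m -> below m -> below p.
  move=> Epm Bm q Hq; apply: Bm.
  by apply: Relation_Operators.rt1n_trans Hq.
have below0 m : below m -> P m.
  by apply; apply: Relation_Operators.rt1n_refl.
have RP p q : below p -> below q -> R p q.
  elim/(well_founded_ind wfE): p q => p IH q Bp Bq a b Ep Eq Ha Hb.
  have Ma a' : mem S a' a <-> mem tru a' a by apply: memE; rewrite ?Ep //; apply: below0.
  have Mb b' : mem S b' b <-> mem tru b' b by apply: memE; rewrite ?Eq //; apply: below0.
  have QE a' b' : mem tru a' a -> mem tru b' b -> Q a' b' <-> Veq (den a') (den b').
    move=> [[Ea' Va'] _] [[Eb' Vb'] _]; rewrite Ep in Ea'; rewrite Eq in Eb'.
    by apply: (IH _ Ea' (nlevel b')) => //; apply: belowE; eassumption.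
  rewrite (clExt HS) // (clExt HT) //; split=> -[H1 H2]; split.
  - move=> a' Ma'; have [b' Mb' Qb'] := H1 a' ((Ma a').2 Ma').
    by exists b'; [apply/Mb | apply/QE => //; apply/Mb].
  - move=> b' Mb'; have [a' Ma' Qb'] := H2 b' ((Mb b').2 Mb').
    by exists a'; [apply/Ma | apply/QE => //; apply/Ma].
  - move=> a' /Ma Ma'; have [b' Mb' Qb'] := H1 a' Ma'.
    by exists b'; [apply/Mb | apply/QE].
  - move=> b' /Mb Mb'; have [a' Ma' Qb'] := H2 b' Mb'.
    by exists a'; [apply/Ma | apply/QE].
have PP m : below m.
  elim/(well_founded_ind wfE): m => m IH p Hp.
  case: Hp => [|q {}p Hq]; last exact: IH.
  elim=> [i j|i j||f IHf g IHg|f IHf] d l Hd Hl.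
  - have [Ei Vi] := ok_nnth i Hd Hl; have [Ej Vj] := ok_nnth j Hd Hl.
    rewrite (clEq HS) // (clEq HT) //.
    by apply: (RP (nlevel (nnth d l i)) (nlevel (nnth d l j))) => //; apply: IH.
  - have [Ei Vi] := ok_nnth i Hd Hl; have [Ej Vj] := ok_nnth j Hd Hl.
    rewrite (clIn HS) // (clIn HT) //.
    have QE b : mem tru b (nnth d l j) -> Q (nnth d l i) b <-> Veq (den (nnth d l i)) (den b).
      move=> [[Eb Vb] _].
      apply: (RP (nlevel (nnth d l i)) (nlevel b)) => //; first exact: IH.
      by apply: belowE Eb _; apply: IH.
    have ME b := memE (nnth d l j) b (below0 _ (IH _ Ej)) Vj.
    split=> -[b Mb Qb]; exists b; try exact/ME.
      by apply/QE => //; apply/ME.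
    exact/QE.
  - split=> H; first by case: (clBot HS Hd Hl H).
    by case: (clBot HT Hd Hl H).
  - rewrite (clImp HS) // (clImp HT) //.
    by have := IHf _ _ Hd Hl; have := IHg _ _ Hd Hl; tauto.
  - rewrite (clAll HS) // (clAll HT) //; split=> H a Ha.
      by apply/IHf; [|apply/okl_cons|apply: H].
    by apply/IHf; [|apply/okl_cons|apply: H].
split=> [m|a b]; first exact: below0.
by apply: (RP (nlevel a) (nlevel b)).
Qed.

End Denotation.

(* Zermelo numerals. *)
Fixpoint zn (k : nat) : V :=
  if k is k'.+1 then VSet (fun _ : unit => zn k')
  else VSet (fun v : False => match v return V with end).

(** With [Veq_znS], this determines the numerals by membership alone, a form that transfers to hulls
    and to truth tables. *)
Lemma Veq_zn0 x : Veq x (zn 0) <-> forall v, ~ Vin v x.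
Proof.
by rewrite VeqP; split=> H v; [rewrite H | split=> [/H|]] => // -[].
Qed.

Lemma Veq_znS x k : Veq x (zn k.+1) <->
  (exists2 v, Vin v x & Veq v (zn k)) /\ (forall v, Vin v x -> Veq v (zn k)).
Proof.
have inS v : Vin v (zn k.+1) <-> Veq v (zn k) by split=> [[]|H]; last exists tt.
rewrite VeqP; split=> [H|[[w Hw Ew] H] v].
  split=> [|v /H/inS//]; exists (zn k); last exact: Veq_refl.
  exact/H/inS/Veq_refl.
rewrite inS; split=> [/H//|Ev].
by apply: Vin_eql Hw; apply: Veq_trans Ew (Veq_sym Ev).
Qed.

Lemma zn_inj j k : Veq (zn j) (zn k) -> j = k.
Proof.
elim: j k => [|j IH] [|k] //.
- by move=> /Veq_znS[[v [[]]]].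
- by move=> /Veq_zn0/(_ (zn j))[]; exists tt; apply: Veq_refl.
- move=> /Veq_znS[_ H]; congr S; apply/IH/H.
  by exists tt; apply: Veq_refl.
Qed.

Lemma collapse_exists (E : nat -> nat -> Prop) :
  well_founded E -> exists c, collapses E c.
Proof.
move=> wfE.
pose F q (rec : forall p, E p q -> V) :=
  VSet (fun p : {p | E p q} => rec (sval p) (svalP p)).
pose c := Fix wfE (fun=> V) F.
have cE q : c q = VSet (fun p : {p | E p q} => c (sval p)).
  rewrite /c Fix_eq //= => x f g fg; rewrite /F; congr VSet.
  by apply: funext => -[p Hp] /=.
exists c => q v; rewrite cE; split=> [[[p Hp] /= Ev]|[p Hp Ev]]; first by exists p.
by exists (exist _ p Hp).
Qed.

(** * Coding of formulas and names by natural numbers *)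

(** A polynomial, so that arithmetical terms express it. It is injective but not surjective, and it
    bounds its arguments, so codes can be analysed by strong induction. *)
Definition npair (a b : nat) : nat := (a + b) * (a + b) + a.

Lemma npair_inj a b a' b' : npair a b = npair a' b' -> a = a' /\ b = b'.
Proof.
rewrite /npair => H; have [lt|lt|eq] := ltngtP (a + b) (a' + b'); first by nia.
  by nia.
by rewrite eq in H; lia.
Qed.

Lemma npair_gel a b : a <= npair a b. Proof. rewrite /npair; nia. Qed.
Lemma npair_ger a b : b <= npair a b. Proof. rewrite /npair; nia. Qed.
Lemma npair_gtr a b : 0 < a -> b < npair a b. Proof. rewrite /npair; nia. Qed.

Fixpoint cfml (f : sfml) : nat :=
  match f with
  | SEq i j => npair 0 (npair i j)
  | SIn i j => npair 1 (npair i j)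
  | SBot => npair 2 0
  | SImp f g => npair 3 (npair (cfml f) (cfml g))
  | SAll f => npair 4 (cfml f)
  end.

Definition cname3 (p f l : nat) : nat := npair p (npair f l).
(** The successor separates nonempty lists from the code 0 of the empty list and makes both
    components smaller than the code. *)
Definition ccons (a l : nat) : nat := (npair a l).+1.

Fixpoint cnlist (l : nlist nat) : nat :=
  if l is NCons p f ps r then ccons (cname3 p (cfml f) (cnlist ps)) (cnlist r)
  else 0.

Definition cname (a : name nat) : nat :=
  cname3 (nlevel a) (cfml (nfml a)) (cnlist (nparams a)).

Lemma cfml_inj : injective cfml.
Proof.
elim=> [i j|i j||f IHf g IHg|f IHf] [i' j'|i' j'||f' g'|f'] //= /npair_inj[] //.
- by move=> _ /npair_inj[-> ->].
- by move=> _ /npair_inj[-> ->].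
- by move=> _ /npair_inj[/IHf-> /IHg->].
- by move=> _ /IHf->.
Qed.

Lemma cname3_inj p f l p' f' l' :
  cname3 p f l = cname3 p' f' l' -> [/\ p = p', f = f' & l = l'].
Proof. by move=> /npair_inj[-> /npair_inj[-> ->]]. Qed.

Lemma ccons_inj a l a' l' : ccons a l = ccons a' l' -> a = a' /\ l = l'.
Proof. by case=> /npair_inj. Qed.

Lemma cnlist_inj : injective cnlist.
Proof.
elim=> [|p f ps IHps r IHr] [|p' f' ps' r'] //= /ccons_inj.
by move=> [/cname3_inj[-> /cfml_inj-> /IHps->] /IHr->].
Qed.

Lemma cname_inj : injective cname.
Proof.
by move=> [p f ps] [p' f' ps'] /cname3_inj[/= -> /cfml_inj-> /cnlist_inj->].
Qed.

Lemma inj_surj (T : Type) (t0 : T) (h : T -> nat) :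
  injective h -> exists g : nat -> T, cancel h g.
Proof.
move=> h_inj; have /choice[g Hg] n : exists t, forall u, h u = n -> u = t.
  have [[t Ht]|Hn] := pselect (exists t, h t = n).
    by exists t => u Hu; apply: h_inj; rewrite Hu.
  by exists t0 => u Hu; case: Hn; exists u.
by exists g => t; rewrite -(Hg _ _ erefl).
Qed.

(** * Renaming of levels and countable hulls *)

Section MapNames.

Variables (X Y : Type) (e : X -> Y).

Fixpoint nlmap (l : nlist X) : nlist Y :=
  if l is NCons p f ps r then NCons (e p) f (nlmap ps) (nlmap r) else NNil.

Definition nmap (a : name X) : name Y :=
  Name (e (nlevel a)) (nfml a) (nlmap (nparams a)).

Lemma nmap_nnth d l k : nmap (nnth d l k) = nnth (nmap d) (nlmap l) k.
Proof. by elim: l k => [|p f ps _ r IH] [|k] /=. Qed.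

Lemma nlmap_cons a l : nlmap (ncons a l) = ncons (nmap a) (nlmap l).
Proof. by []. Qed.

Variable E : Y -> Y -> Prop.

Lemma okl_map m l : okl E (e m) (nlmap l) <-> okl (fun p q => E (e p) (e q)) m l.
Proof.
by elim: l m => //= p f ps IHps r IHr m; split=> -[H1 /IHps H2 /IHr H3].
Qed.

Lemma valid_map a : valid E (nmap a) <-> valid (fun p q => E (e p) (e q)) a.
Proof. exact: okl_map. Qed.

Lemma ok_map m a : ok E (e m) (nmap a) <-> ok (fun p q => E (e p) (e q)) m a.
Proof. by rewrite /ok valid_map. Qed.

End MapNames.

Fixpoint addrs (X : Type) (l : nlist X) : seq X :=
  if l is NCons p f ps r then p :: addrs ps ++ addrs r else [::].

Lemma eq_nlmap (Y : Type) (e e' : nat -> Y) l :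
  {in addrs l, e =1 e'} -> nlmap e l = nlmap e' l.
Proof.
elim: l => //= p f ps IHps r IHr H; rewrite H ?mem_head //.
rewrite IHps ?IHr // => i Hi; apply: H;
  by rewrite inE mem_cat Hi ?orbT.
Qed.

(** Occurrence in [addrs l] is expressed by positions, because [Y] carries no decidable equality. *)
Lemma nlmap_preimage (X Y : Type) (y0 : Y) (e : X -> Y) l :
  (forall j, j < size (addrs l) -> exists i, e i = nth y0 (addrs l) j) ->
  exists l', nlmap e l' = l.
Proof.
elim: l => [|p f ps IHps r IHr] /= H; first by exists NNil.
have [i /= Hi] := H 0 isT.
have [|ps' <-] := IHps.
  move=> j Hj; have [|k Hk] := H j.+1; first by rewrite ltnS size_cat ltn_addr.
  by exists k; rewrite Hk /= nth_cat Hj.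
have [|r' <-] := IHr.
  move=> j Hj; have [|k Hk] := H (size (addrs ps) + j).+1.
    by rewrite ltnS size_cat ltn_add2l.
  by exists k; rewrite Hk /= nth_cat ltnNge leq_addr /= addKn.
by exists (NCons i f ps' r'); rewrite /= Hi.
Qed.

(** Downward Löwenheim-Skolem: the hull consists of the values of finite trees built from countably
    many Skolem functions, and these trees can be enumerated. *)
Lemma skolem_hull (X : Type) (x0 : X)
    (R : nat -> nat -> sfml -> nlist X -> name X -> Prop) :
  exists e : nat -> X, (exists i, e i = x0) /\
    forall t k f l, (exists a, R t k f (nlmap e l) a) ->
      exists a, R t k f (nlmap e l) (nmap e a).
Proof.
have [dfml dfmlK] := inj_surj SBot cfml_inj.
have [dnl dnlK] := inj_surj NNil cnlist_inj.
have /choice[W HW] (q : nat * nat * sfml * nlist X) : exists a : name X,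
    (exists b, R q.1.1.1 q.1.1.2 q.1.2 q.2 b) -> R q.1.1.1 q.1.1.2 q.1.2 q.2 a.
  have [[b Hb]|Hn] := pselect (exists b, R q.1.1.1 q.1.1.2 q.1.2 q.2 b).
    by exists b.
  by exists (Name x0 SBot NNil).
pose ad (a : name X) := nlevel a :: addrs (nparams a).
(* The label [n] codes a Skolem function, an argument list whose levels are positions in [s], and an
   index [j]; the value is the [j]-th level occurring in the chosen witness. *)
pose G (n : nat) (s : seq X) : X :=
  if unpickle n is Some (t, k, f, l, j) then
    nth x0 (ad (W (t, k, dfml f, nlmap (nth x0 s) (dnl l)))) j else x0.
pose ev := fix ev (u : GenTree.tree nat) : X :=
  match u with
  | GenTree.Leaf _ => x0
  | GenTree.Node n us => G n (map ev us)
  end.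
pose tr (i : nat) : GenTree.tree nat := odflt (GenTree.Leaf 0) (unpickle i).
pose e i := ev (tr i).
have eP u : e (pickle u) = ev u by rewrite /e /tr pickleK.
exists e; split; first by exists (pickle (GenTree.Leaf 0 : GenTree.tree nat)); rewrite eP.
move=> t k f l /(HW (t, k, f, _)) /=; set a := W _ => Ha.
suff [a' Ea'] : exists a', nmap e a' = a by exists a'; rewrite Ea'.
(* The first [N] trees, taken as children, supply every level [e i] that [l] refers to. *)
pose N := (\max_(i <- addrs l) i).+1.
have EN : nlmap (nth x0 (map ev (mkseq tr N))) l = nlmap e l.
  apply: eq_nlmap => i Hi; have HiN : i < N by rewrite ltnS; apply: leq_bigmax_seq.
  by rewrite (nth_map (GenTree.Leaf 0)) ?size_mkseq // nth_mkseq.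
have Hr j : exists i, e i = nth x0 (ad a) j.
  exists (pickle (GenTree.Node (pickle (t, k, cfml f, cnlist l, j)) (mkseq tr N))).
  by rewrite eP /= /G pickleK dfmlK dnlK EN.
have [i /= Hi] := Hr 0.
have [|l' Hl'] := @nlmap_preimage _ _ x0 e (nparams a).
  by move=> j _; have [i' Hi'] := Hr j.+1; exists i'.
by exists (Name i (nfml a) l'); rewrite /nmap /= Hi Hl'; case: (a).
Qed.

Definition Vsub (p q : V) : Prop := exists a : Vidx q, p = Velt a.

Lemma wf_Vsub : well_founded Vsub.
Proof. by elim=> A f IH; constructor => _ [a ->]; apply: IH. Qed.

Lemma collapses_Vsub : collapses Vsub id.
Proof.
move=> q v; split=> [[a Ea]|[p [a ->] Ev]]; last by exists a.
by exists (Velt a) => //; exists a.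
Qed.

(** Take a countable hull around a name of [z], with sets themselves as levels, and pull [Vsub] back
    to the natural numbers. Truth read through the hull satisfies the clauses for the pulled-back
    relation, so by uniqueness it is truth along its collapse. *)
Lemma Lstage_countable z alpha : Vin z (Lstage alpha) ->
  exists E : nat -> nat -> Prop, well_founded E /\
    forall c, collapses E c -> exists m z', Vin z' (Lstage (c m)) /\
      forall k, Vin (zn k) z' <-> Vin (zn k) z.
Proof.
move=> /(Lstage_names wf_Vsub collapses_Vsub)[nu Hnu Enu].
pose T := @tru V id; pose D := @den V id.
have HT := tru_clauses wf_Vsub collapses_Vsub.
have memT := mem_tru wf_Vsub collapses_Vsub.
(* The witnesses to be kept in the hull: the name of [z]; counterexamples to universal formulas;
   members equal to a given set; members missing from a given set; members that are, or are not, the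
   numeral [k]; arbitrary members. *)
pose R t k f (l : nlist V) x :=
  match t, l with
  | 0, _ => x = nu
  | 1, NCons p _ _ (NCons q g qs r) =>
      ok Vsub p x /\ ~ T p f (Name q g qs) (ncons x r)
  | 2, NCons p g ps (NCons q h qs _) =>
      mem Vsub T x (Name q h qs) /\ Veq (D (Name p g ps)) (D x)
  | 3, NCons p g ps (NCons q h qs _) =>
      mem Vsub T x (Name q h qs) /\ ~ Vin (D x) (D (Name p g ps))
  | 4, NCons p g ps _ => mem Vsub T x (Name p g ps) /\ Veq (D x) (zn k)
  | 5, NCons p g ps _ => mem Vsub T x (Name p g ps) /\ ~ Veq (D x) (zn k)
  | 6, NCons p g ps _ => mem Vsub T x (Name p g ps)
  | _, _ => False
  end.
have [e [[m Em] He]] := skolem_hull alpha R.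
pose E i j := Vsub (e i) (e j).
have wfE : well_founded E.
  move=> i; move Ei : (e i) => v; elim/(well_founded_ind wf_Vsub): v i Ei => v IH i Ei.
  by constructor => j Eji; apply: IH erefl; rewrite -Ei.
have [nu' Hnu'] : exists a, nmap e a = nu.
  by have [|a Ha] := He 0 0 SBot NNil; [exists nu | exists a].
exists E; split=> // c Hc; exists m, (den c nu').
pose S m f d l := T (e m) f (nmap e d) (nlmap e l).
pose Q a b := Veq (D (nmap e a)) (D (nmap e b)).
have memS b a : mem E S b a <-> mem Vsub T (nmap e b) (nmap e a).
  by rewrite /mem /S nlmap_cons /= ok_map.
have in_hull a b x : mem Vsub T x (nmap e b) -> Veq (D (nmap e a)) (D x) ->
    exists2 b', mem E S b' b & Q a b'.
  move=> Hx Ex; have [|b' [Hb' Eb']] := He 2 0 SBot (ncons a (ncons b NNil)).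
    by exists x; split.
  by exists b' => //; apply/memS.
have notin_hull a b : (forall x, mem E S x b -> Vin (D (nmap e x)) (D (nmap e a))) ->
    forall x, mem Vsub T x (nmap e b) -> Vin (D x) (D (nmap e a)).
  move=> H x Hx; apply: contrapT => Hn.
  have [|x' [Hx' []]] := He 3 0 SBot (ncons a (ncons b NNil)).
    by exists x; split.
  exact/H/memS.
have HS : clauses E S Q.
  split=> [m' i j d l /ok_map Hd /okl_map Hl|m' i j d l /ok_map Hd /okl_map Hl|
    m' d l /ok_map Hd /okl_map Hl|m' f g d l /ok_map Hd /okl_map Hl|
    m' f d l /ok_map Hd /okl_map Hl|a b /valid_map Ha /valid_map Hb].
  - by rewrite /S /Q /T (clEq HT) // !nmap_nnth.
  - rewrite /S /T (clIn HT) // -!nmap_nnth; split=> [[x Hx Ex]|[b' /memS Hb' Eb']].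
      exact: in_hull Hx Ex.
    by exists (nmap e b').
  - exact: (clBot HT Hd Hl).
  - by rewrite /S /T (clImp HT).
  - rewrite /S /T (clAll HT) //; split=> H.
      by move=> a /ok_map Ha; apply: (H _ Ha).
    move=> x Hx; apply: contrapT => Hn.
    (* A dummy name passes the level [m'], and the default [d] travels as the second entry, since
       [R] receives all its data in one list. *)
    have [|a [Ha []]] := He 1 0 f (ncons (Name m' SBot NNil) (ncons d l)).
      by exists x; split=> //; case: (d) Hn.
    by have := H a ((ok_map _ _ _ _).1 Ha); rewrite nlmap_cons; case: (d).
  - rewrite /Q /D (clExt HT) //; split=> -[H1 H2]; split.
    + move=> a' /memS/H1[x Hx Ex]; exact: in_hull Hx Ex.
    + move=> b' /memS/H2[x Hx Ex]; have [a' Ha' Ea'] := in_hull b' a x Hx (Veq_sym Ex).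
      by exists a' => //; apply: Veq_sym.
    + move=> x Hx; apply/memT; move: x Hx; apply: notin_hull => a' /H1[b' /memS Hb' Eb'].
      by apply/memT; exists (nmap e b').
    + move=> x Hx; have: Vin (D x) (D (nmap e a)).
        move: x Hx; apply: notin_hull => b' /H2[a' /memS Ha' Ea'].
        by apply/memT; exists (nmap e a') => //; apply: Veq_sym.
      by move=> /memT[a' Ha' Ea']; exists a' => //; apply: Veq_sym.
have [SE _] := clauses_unique wfE Hc HS.
have memE a b : valid E a -> mem E (tru c) b a <-> mem Vsub T (nmap e b) (nmap e a).
  move=> Ha; rewrite -memS /mem; split=> -[Hb H]; split=> //.
    by apply/SE => //; apply/okl_cons.
  by apply/SE => //; apply/okl_cons.
have mem_c := mem_tru wfE Hc.
have hull1 t k a x : R t k SBot (ncons (nmap e a) NNil) x ->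
    exists b, R t k SBot (ncons (nmap e a) NNil) (nmap e b).
  by move=> Hx; apply: (He t k SBot (ncons a NNil)); exists x.
(* A name and its image need not denote the same set, but by induction on [k] they denote the same
   numerals. *)
have znE k a : valid E a -> Veq (den c a) (zn k) <-> Veq (D (nmap e a)) (zn k).
  elim: k a => [|k IH] a Ha.
    rewrite !Veq_zn0; split=> H v.
      move=> /memT[x Hx Ex]; have [b /(memE _ _ Ha) Hb] := hull1 6 0 a x Hx.
      by apply: (H (den c b)); apply/mem_c; exists b => //; apply: Veq_refl.
    move=> /mem_c[b /(memE _ _ Ha) Hb _]; apply: (H (D (nmap e b))).
    by apply/memT; exists (nmap e b) => //; apply: Veq_refl.
  have Vb b : mem E (tru c) b a -> valid E b by case=> -[].
  rewrite !Veq_znS; split=> -[[v Hv Ev] H]; split.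
  - have [b Hb Eb] := (mem_c _ _).1 Hv; exists (D (nmap e b)).
      by apply/memT; exists (nmap e b); [apply/memE | apply: Veq_refl].
    by apply/IH; [apply: Vb | apply: Veq_trans (Veq_sym Eb) Ev].
  - move=> w /memT[x Hx Ex]; apply: Veq_trans Ex _; apply: contrapT => Hn.
    have [b [/(memE _ _ Ha) Hb]] := hull1 5 k a x (conj Hx Hn); case.
    by apply/IH; [apply: Vb | apply/H/mem_c; exists b => //; apply: Veq_refl].
  - have [x Hx Ex] := (memT _ _).1 Hv.
    have [b [/(memE _ _ Ha) Hb Eb]] :=
      hull1 4 k a x (conj Hx (Veq_trans (Veq_sym Ex) Ev)).
    exists (den c b); first by apply/mem_c; exists b => //; apply: Veq_refl.
    by apply/IH => //; apply: Vb.
  - move=> w /mem_c[b Hb Eb]; apply: Veq_trans Eb _; apply/IH; first exact: Vb.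
    by apply/H/memT; exists (nmap e b); [apply/memE | apply: Veq_refl].
have Hnu2 : ok E m nu' by apply/ok_map; rewrite Hnu' Em.
split=> [|k]; first by apply/(Lstage_names wfE Hc); exists nu' => //; apply: Veq_refl.
have Vnu := ok_valid Hnu2.
have -> : Vin (zn k) z <-> Vin (zn k) (D (nmap e nu')).
  by apply: Vin_congr; [apply: Veq_refl | rewrite Hnu'].
rewrite mem_c; split=> [[b Hb Eb]|/memT[x Hx Ex]].
  apply/memT; exists (nmap e b); first exact/memE.
  by apply: Veq_sym; apply/znE; [apply: ok_valid Hb.1 | apply: Veq_sym].
have [b [/(memE _ _ Vnu) Hb Eb]] := hull1 4 k nu' x (conj Hx (Veq_sym Ex)).
exists b => //; apply: Veq_sym; apply/znE => //; exact: ok_valid Hb.1.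
Qed.

(** * Arithmetical definitions *)

Definition apred := (nat -> nat) -> (nat -> nat) -> (nat -> nat) -> Prop.
Definition afun := (nat -> nat) -> (nat -> nat) -> (nat -> nat) -> nat.

Definition arith (P : apred) : Prop :=
  exists th, forall x y e, asat x y e th <-> P x y e.

Definition aexpr (t : afun) : Prop :=
  exists u, forall x y e, aval x y e u = t x y e.

Lemma aexpr_var i : aexpr (fun _ _ e => e i).
Proof. by exists (AVar i). Qed.

Lemma aexpr_0 : aexpr (fun _ _ _ => 0).
Proof. by exists AZero. Qed.

Lemma aexpr_S t : aexpr t -> aexpr (fun x y e => (t x y e).+1).
Proof. by move=> [u Hu]; exists (ASucc u) => x y e /=; rewrite Hu. Qed.

Lemma aexpr_add t u : aexpr t -> aexpr u -> aexpr (fun x y e => t x y e + u x y e).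
Proof.
by move=> [t' Ht] [u' Hu]; exists (AAdd t' u') => x y e /=; rewrite Ht Hu.
Qed.

Lemma aexpr_mul t u : aexpr t -> aexpr u -> aexpr (fun x y e => t x y e * u x y e).
Proof.
by move=> [t' Ht] [u' Hu]; exists (AMul t' u') => x y e /=; rewrite Ht Hu.
Qed.

Lemma aexpr_x t : aexpr t -> aexpr (fun x y e => x (t x y e)).
Proof. by move=> [u Hu]; exists (AFun1 u) => x y e /=; rewrite Hu. Qed.

Lemma aexpr_y t : aexpr t -> aexpr (fun x y e => y (t x y e)).
Proof. by move=> [u Hu]; exists (AFun2 u) => x y e /=; rewrite Hu. Qed.

Lemma arith_eq t u : aexpr t -> aexpr u -> arith (fun x y e => t x y e = u x y e).
Proof.
by move=> [t' Ht] [u' Hu]; exists (AEq t' u') => x y e /=; rewrite Ht Hu.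
Qed.

Lemma arith_imp P Q :
  arith P -> arith Q -> arith (fun x y e => P x y e -> Q x y e).
Proof.
move=> [p Hp] [q Hq]; exists (AImp p q) => x y e /=.
by have := Hp x y e; have := Hq x y e; tauto.
Qed.

Lemma arith_not P : arith P -> arith (fun x y e => ~ P x y e).
Proof.
move=> [p Hp]; exists (AImp p ABot) => x y e /=.
by have := Hp x y e; tauto.
Qed.

(** The premise is in de Bruijn form: the bound number becomes variable 0 and the others shift,
    which is what [scons n e] computes to. *)
Lemma arith_all (P : nat -> apred) :
  arith (fun x y e => P (e 0) x y (fun k => e k.+1)) ->
  arith (fun x y e => forall n, P n x y e).
Proof.
move=> [p Hp]; exists (AAll p) => x y e /=; split=> H n.
  exact/(Hp x y (scons n e))/H.
exact/Hp/(H n).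
Qed.

Lemma arith_equiv P Q :
  (forall x y e, P x y e <-> Q x y e) -> arith P -> arith Q.
Proof. by move=> PQ [p Hp]; exists p => x y e; rewrite Hp. Qed.

Lemma arith_ex (P : nat -> apred) :
  arith (fun x y e => P (e 0) x y (fun k => e k.+1)) ->
  arith (fun x y e => exists n, P n x y e).
Proof.
move=> HP; apply: (@arith_equiv (fun x y e => ~ forall n, ~ P n x y e)).
  move=> x y e; split=> [/existsNP[n /contrapT Hn]|[n Hn] H]; first by exists n.
  exact: H Hn.
by apply/arith_not/(@arith_all (fun n x y e => ~ P n x y e))/arith_not.
Qed.

Lemma arith_and P Q :
  arith P -> arith Q -> arith (fun x y e => P x y e /\ Q x y e).
Proof.
move=> HP HQ; apply: (@arith_equiv (fun x y e => ~ (P x y e -> ~ Q x y e))).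
  by move=> x y e; split=> [/not_implyP[? /contrapT]|[p q] /(_ p)].
by apply/arith_not/arith_imp/arith_not.
Qed.

Lemma arith_or P Q :
  arith P -> arith Q -> arith (fun x y e => P x y e \/ Q x y e).
Proof.
move=> HP HQ; apply: (@arith_equiv (fun x y e => ~ P x y e -> Q x y e)).
  move=> x y e; split=> [H|[]//]; have [p|np] := pselect (P x y e); first by left.
  by right; apply: H.
by apply: arith_imp HQ; apply: arith_not.
Qed.

Lemma arith_iff P Q :
  arith P -> arith Q -> arith (fun x y e => P x y e <-> Q x y e).
Proof. by move=> HP HQ; apply: arith_and; apply: arith_imp. Qed.

(** Negation is tried before implication, to which it unfolds, and implication before the universal
    quantifier. *)
Ltac arith_tac := repeat first
  [ apply: aexpr_var | apply: aexpr_0 | apply: aexpr_S | apply: aexpr_add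
  | apply: aexpr_mul | apply: aexpr_x | apply: aexpr_y
  | apply: arith_eq | apply: arith_not | apply: arith_iff
  | apply: arith_and | apply: arith_or | apply: arith_ex
  | apply: arith_imp | apply: arith_all ].

(** * Relations coded by reals and the arithmetical matrix *)

(** Oddness is written with addition and a quantifier, which the arithmetical language provides. *)
Definition Er (x : nat -> nat) (p q : nat) : Prop :=
  exists k, x (npair p q) = (k + k).+1.

(* [y] is a table of seven predicates on codes: formulas, names at a level, lists of
   names at a level, n-th entry of a list (with default), truth at a level, equality
   of denotations, and denoting a numeral. *)
Section Tables.

Variables x y : nat -> nat.

(** Residues modulo 7 interleave the tables, so that one function variable carries all of them. *)
Definition tab (j n : nat) : Prop := y (7 * n + j) <> 0.

Definition tF (f : nat) : Prop := tab 0 f.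
Definition tLev (m a : nat) : Prop := tab 1 (npair m a).
Definition tLst (m l : nat) : Prop := tab 2 (npair m l).
Definition tN (d l i a : nat) : Prop := tab 3 (npair d (npair l (npair i a))).
Definition tS (m f d l : nat) : Prop := tab 4 (npair m (npair f (npair d l))).
Definition tQ (a b : nat) : Prop := tab 5 (npair a b).
Definition tZ (a k : nat) : Prop := tab 6 (npair a k).

Definition tMem (b a : nat) : Prop := exists p f l,
  a = cname3 p f l /\ tLev p b /\ tS p f b (ccons b l).
Definition tV (a : nat) : Prop := exists p f l,
  a = cname3 p f l /\ tF f /\ tLst p l.
Definition tM (a k : nat) : Prop := exists b, tMem b a /\ tZ b k.

Definition syntax_clauses : Prop :=
  (forall f, tF f <->
    (exists i j, f = npair 0 (npair i j)) \/
    (exists i j, f = npair 1 (npair i j)) \/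
    f = npair 2 0 \/
    (exists g h, f = npair 3 (npair g h) /\ tF g /\ tF h) \/
    (exists g, f = npair 4 g /\ tF g)) /\
  (forall m a, tLev m a <-> exists p f l,
    a = cname3 p f l /\ Er x p m /\ tF f /\ tLst p l) /\
  (forall m l, tLst m l <-> l = 0 \/
    exists a r, l = ccons a r /\ tLev m a /\ tLst m r) /\
  (forall m d l i a, tLev m d -> tLst m l -> tN d l i a <->
    (l = 0 /\ a = d) \/
    exists b r, l = ccons b r /\
      ((i = 0 /\ a = b) \/ exists i', i = i'.+1 /\ tN d r i' a)).

(** The record [clauses] transcribed to codes, followed by the recursive description of numerals. *)
Definition truth_clauses : Prop :=
  (forall m d l i j, tLev m d -> tLst m l -> tS m (npair 0 (npair i j)) d l <->
    exists a b, tN d l i a /\ tN d l j b /\ tQ a b) /\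
  (forall m d l i j, tLev m d -> tLst m l -> tS m (npair 1 (npair i j)) d l <->
    exists a b b', tN d l i a /\ tN d l j b /\ tMem b' b /\ tQ a b') /\
  (forall m d l, tLev m d -> tLst m l -> ~ tS m (npair 2 0) d l) /\
  (forall m d l f g, tLev m d -> tLst m l -> tF f -> tF g ->
    tS m (npair 3 (npair f g)) d l <-> (tS m f d l -> tS m g d l)) /\
  (forall m d l f, tLev m d -> tLst m l -> tF f ->
    tS m (npair 4 f) d l <-> forall a, tLev m a -> tS m f d (ccons a l)) /\
  (forall a b, tV a -> tV b -> tQ a b <->
    (forall a', tMem a' a -> exists b', tMem b' b /\ tQ a' b') /\
    (forall b', tMem b' b -> exists a', tMem a' a /\ tQ a' b')) /\
  (forall a, tV a -> tZ a 0 <-> forall b, ~ tMem b a) /\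
  (forall a k, tV a -> tZ a k.+1 <->
    (exists b, tMem b a /\ tZ b k) /\ (forall b, tMem b a -> tZ b k)).

(** The name [a] denotes any set of coded pairs: at infinitely many arguments it has a value, and
    all its values there exceed that of [x]. Both comparisons are expressed by sums. *)
Definition undominated : Prop := exists m a, tLev m a /\
  forall N, exists j, (exists k, tM a (npair (N + j) k)) /\
    forall k i, x (N + j) = k + i -> ~ tM a (npair (N + j) k).

(* [y] is both a possible descending sequence and a possible truth table. *)
Definition matrix : Prop :=
  ~ (forall n, Er x (y n.+1) (y n)) /\
  (syntax_clauses /\ truth_clauses -> undominated).

End Tables.

Lemma arith_matrix : arith (fun x y _ => matrix x y).
Proof.
rewrite /matrix /syntax_clauses /truth_clauses /undominated /tM /tV /tMem.
rewrite /tF /tLev /tLst /tN /tS /tQ /tZ /tab /Er /cname3 /ccons /npair.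
arith_tac.
Qed.

(** * Correctness and existence of truth tables *)

Section TableCorrectness.

Variables x y : nat -> nat.
Hypothesis Hsyn : syntax_clauses x y.

Lemma tFE f : tF y f <-> exists g, f = cfml g.
Proof.
have [HF _] := Hsyn.
elim/ltn_ind: f => f IH; rewrite HF; split.
  case=> [[i [j ->]]|[[i [j ->]]|[->|[[g [h [Ef [Fg Fh]]]]|[g [Ef Fg]]]]]].
  - by exists (SEq i j).
  - by exists (SIn i j).
  - by exists SBot.
  - have lt g' : g' <= npair g h -> g' < f.
      by move=> le; rewrite Ef; apply: leq_ltn_trans le _; apply: npair_gtr.
    have [g' Eg] := (IH _ (lt _ (npair_gel g h))).1 Fg.
    have [h' Eh] := (IH _ (lt _ (npair_ger g h))).1 Fh.
    by exists (SImp g' h'); rewrite Ef Eg Eh.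
  - have [|g' Eg] := (IH g _).1 Fg; first by rewrite Ef; apply: npair_gtr.
    by exists (SAll g'); rewrite Ef Eg.
move=> [[i j|i j||g h|g] Ef]; rewrite Ef /=.
- by left; exists i, j.
- by right; left; exists i, j.
- by right; right; left.
- right; right; right; left; exists (cfml g), (cfml h).
  have lt g' : g' <= npair (cfml g) (cfml h) -> g' < f.
    by move=> le; rewrite Ef; apply: leq_ltn_trans le _; apply: npair_gtr.
  split=> //; split; apply/IH; try by eexists.
    exact/lt/npair_gel.
  exact/lt/npair_ger.
- right; right; right; right; exists (cfml g); split=> //.
  apply/IH; last by exists g.
  by rewrite Ef; apply: npair_gtr.
Qed.

(** Names and lists are mutually recursive; unfolding the clause for the head name once leaves a
    single strong induction on the code of the list, for all levels [m] together. *)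
Lemma tLstE m l : tLst y m l <-> exists2 l', l = cnlist l' & okl (Er x) m l'.
Proof.
have [_ [HLev [HLst _]]] := Hsyn.
elim/ltn_ind: l m => l IH m; rewrite HLst; split.
  case=> [->|[a [r [El [La Lr]]]]]; first by exists NNil.
  have [p [f [s [Ea [Ep [/tFE[f' Ef] Ls]]]]]] := (HLev _ _).1 La.
  have [r' Er' Or] : exists2 l', r = cnlist l' & okl (Er x) m l'.
    by apply/IH => //; rewrite El ltnS; apply: npair_ger.
  have [s' Es Os] : exists2 l', s = cnlist l' & okl (Er x) p l'.
    apply/IH => //; rewrite El ltnS; apply: leq_trans (npair_gel a r).
    by rewrite Ea; apply: leq_trans (npair_ger p _); apply: npair_ger.
  by exists (NCons p f' s' r') => //=; rewrite El Ea Ef Es Er'.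
move=> [[|p f s r] El] /=; first by left.
move=> [Ep Os Or]; right; exists (cname (Name p f s)), (cnlist r); split=> //.
split; last by apply/IH; [rewrite El ltnS; apply: npair_ger | exists r].
apply/HLev; exists p, (cfml f), (cnlist s); split=> //; split=> //; split.
  by apply/tFE; exists f.
apply/IH; last by exists s.
rewrite El ltnS; apply: leq_trans (npair_gel _ _).
by apply: leq_trans (npair_ger p _); apply: npair_ger.
Qed.

Lemma tVE a : tV y a <-> exists2 a', a = cname a' & valid (Er x) a'.
Proof.
split=> [[p [f [l [Ea [/tFE[f' Ef] /tLstE[l' El Ol]]]]]]|[[p f l] Ea Va]].
  by exists (Name p f' l') => //; rewrite Ea Ef El.
exists p, (cfml f), (cnlist l); split=> //; split; first by apply/tFE; exists f.
by apply/tLstE; exists l.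
Qed.

Lemma tLevE m a : tLev y m a <-> exists2 a', a = cname a' & ok (Er x) m a'.
Proof.
have [_ [HLev _]] := Hsyn; rewrite HLev.
split=> [[p [f [l [Ea [Ep [/tFE[f' Ef] /tLstE[l' El Ol]]]]]]]|[[p f l] Ea [Ep Va]]].
  by exists (Name p f' l'); rewrite ?Ea ?Ef ?El.
exists p, (cfml f), (cnlist l); split=> //; split=> //.
by split; [apply/tFE; exists f | apply/tLstE; exists l].
Qed.

Lemma tV_name a : tV y (cname a) <-> valid (Er x) a.
Proof. by rewrite tVE; split=> [[a' /cname_inj->]|]; last exists a. Qed.

Lemma tLev_name m a : tLev y m (cname a) <-> ok (Er x) m a.
Proof. by rewrite tLevE; split=> [[a' /cname_inj->]|]; last exists a. Qed.

Lemma tLst_name m l : tLst y m (cnlist l) <-> okl (Er x) m l.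
Proof. by rewrite tLstE; split=> [[a' /cnlist_inj->]|]; last exists l. Qed.

Lemma tN_name m d l i a : ok (Er x) m d -> okl (Er x) m l ->
  tN y (cname d) (cnlist l) i a <-> a = cname (nnth d l i).
Proof.
have [_ [_ [_ HN]]] := Hsyn.
move=> /[dup] Od /tLev_name Ld; elim: l i => [|p f ps _ r IH] i Ol.
  rewrite (HN m) //; last exact/tLst_name.
  by split=> [[[]//|[b [r [/=]]]]//|->]; left.
rewrite (HN m) //; last exact/tLst_name.
have Or : okl (Er x) m r by case: Ol.
split=> [[[]//|[b [r' [/ccons_inj[Eb Er'] H]]]]|Ea].
  case: H => [[-> ->]|[i' [-> H]]]; first by rewrite -Eb.
  by move: H; rewrite -Er' => /(IH i' Or).
right; exists (cname (Name p f ps)), (cnlist r); split=> //.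
case: i Ea => [|i] Ea; first by left.
by right; exists i; split=> //; apply/IH.
Qed.

Hypothesis wfE : well_founded (Er x).
Variable c : nat -> V.
Hypothesis Hc : collapses (Er x) c.
Hypothesis Htru : truth_clauses y.

Let S m f d l := tS y m (cfml f) (cname d) (cnlist l).
Let Q a b := tQ y (cname a) (cname b).

Lemma tMem_mem b a : tMem y b (cname a) <-> exists2 b', b = cname b' & mem (Er x) S b' a.
Proof.
split=> [[p [f [l [/cname3_inj[<- <- <-] [/tLevE[b' -> Ob] HS]]]]]|[b' -> [Ob HS]]].
  by exists b'.
exists (nlevel a), (cfml (nfml a)), (cnlist (nparams a)); split=> //.
by split=> //; apply/tLev_name.
Qed.

Lemma table_clauses : clauses (Er x) S Q.
Proof.
have [H0 [H1 [H2 [H3 [H4 [H5 _]]]]]] := Htru.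
split=> [m i j d l Od Ol|m i j d l Od Ol|m d l Od Ol|m f g d l Od Ol|
  m f d l Od Ol|a b Va Vb].
1-5: have Ld := (tLev_name _ _).2 Od; have Ll := (tLst_name _ _).2 Ol.
- rewrite /S /= H0 //; split=> [[a [b [Na [Nb Qab]]]]|Hq].
    by move: Na Nb Qab; rewrite !(tN_name _ _ Od Ol) => -> ->.
  by do 2 eexists; rewrite !(tN_name _ _ Od Ol).
- rewrite /S /= H1 //; split=> [[a [b [b' [Na [Nb [Mb Qab]]]]]]|[b Mb Qb]].
    move: Na Nb Mb Qab; rewrite !(tN_name _ _ Od Ol) => -> ->.
    by move=> /tMem_mem[b2 -> Mb] Qb; exists b2.
  exists (cname (nnth d l i)), (cname (nnth d l j)), (cname b).
  by rewrite !(tN_name _ _ Od Ol) tMem_mem; do !split=> //; exists b.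
- exact: H2.
- by apply: H3 => //; apply/tFE; eexists.
- rewrite /S /= H4 //; last by apply/tFE; eexists.
  split=> H a; first by move=> /tLev_name/H.
  by move=> /tLevE[a' -> /H].
- rewrite /Q H5; [|exact/tV_name|exact/tV_name].
  split=> -[h1 h2]; split.
  + move=> a' Ma; have [|b' [/tMem_mem[b2 -> Mb] Qb]] := h1 (cname a').
      by apply/tMem_mem; exists a'.
    by exists b2.
  + move=> b' Mb; have [|a' [/tMem_mem[a2 -> Ma] Qa]] := h2 (cname b').
      by apply/tMem_mem; exists b'.
    by exists a2.
  + move=> _ /tMem_mem[a' -> /h1[b' Mb Qb]]; exists (cname b'); split=> //.
    by apply/tMem_mem; exists b'.
  + move=> _ /tMem_mem[b' -> /h2[a' Ma Qa]]; exists (cname a'); split=> //.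
    by apply/tMem_mem; exists a'.
Qed.

(** The table solves [clauses], whose solution is unique, so it agrees with actual truth. *)
Lemma tMem_tru b a : valid (Er x) a ->
  tMem y b (cname a) <-> exists2 b', b = cname b' & mem (Er x) (tru c) b' a.
Proof.
move=> Va; have [SE _] := clauses_unique wfE Hc table_clauses.
rewrite tMem_mem; split=> -[b' -> [Ob H]]; exists b' => //; split=> //.
  by apply/SE => //; apply/okl_cons.
by apply/SE => //; apply/okl_cons.
Qed.

Lemma tZE a k : valid (Er x) a -> tZ y (cname a) k <-> Veq (den c a) (zn k).
Proof.
have [_ [_ [_ [_ [_ [_ [H6 H7]]]]]]] := Htru.
have memc := mem_tru wfE Hc.
elim: k a => [|k IH] a Va; have tVa := (tV_name a).2 Va.
  rewrite H6 // Veq_zn0; split=> H.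
    move=> v /memc[b Mb _]; apply: (H (cname b)).
    by apply/tMem_tru => //; exists b.
  move=> _ /(tMem_tru _ Va)[b _ Mb]; apply: (H (den c b)).
  by apply/memc; exists b => //; apply: Veq_refl.
have Vb b : mem (Er x) (tru c) b a -> valid (Er x) b by case=> -[].
rewrite H7 // Veq_znS; split=> [[[b [Hb Zb]] H]|[[v Hv Ev] H]]; split.
    move: Hb Zb => /(tMem_tru _ Va)[b' -> Mb] /(IH _ (Vb _ Mb)) Zb.
    by exists (den c b') => //; apply/memc; exists b' => //; apply: Veq_refl.
  move=> v /memc[b' Mb Ev]; apply: Veq_trans Ev _; apply/(IH _ (Vb _ Mb))/H.
  by apply/tMem_tru => //; exists b'.
  have [b' Mb Eb] := (memc _ _).1 Hv; exists (cname b'); split.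
    by apply/tMem_tru => //; exists b'.
  by apply/(IH _ (Vb _ Mb)); apply: Veq_trans (Veq_sym Eb) Ev.
move=> _ /(tMem_tru _ Va)[b' -> Mb]; apply/(IH _ (Vb _ Mb))/H.
by apply/memc; exists b' => //; apply: Veq_refl.
Qed.

Lemma tME a k : valid (Er x) a -> tM y (cname a) k <-> Vin (zn k) (den c a).
Proof.
move=> Va; rewrite (mem_tru wfE Hc); split.
  move=> [_ [/(tMem_tru _ Va)[b -> Mb] /tZE Zb]]; exists b => //.
  by apply/Veq_sym/Zb; case: Mb => -[].
move=> [b Mb Eb]; exists (cname b); split; first by apply/tMem_tru => //; exists b.
by apply/tZE; [case: Mb => -[] | apply: Veq_sym].
Qed.

End TableCorrectness.

Definition Lundominated (x : nat -> nat) (c : nat -> V) : Prop :=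
  exists m v, Vin v (Lstage (c m)) /\ forall N, exists n, N <= n /\
    (exists k, Vin (zn (npair n k)) v) /\
    forall k, k <= x n -> ~ Vin (zn (npair n k)) v.

Lemma undominatedE x y c : well_founded (Er x) -> collapses (Er x) c ->
  syntax_clauses x y -> truth_clauses y -> undominated x y <-> Lundominated x c.
Proof.
move=> wfE Hc Hsyn Htru.
have ME a k : valid (Er x) a -> tM y (cname a) k <-> Vin (zn k) (den c a).
  exact: tME.
split=> [[m [_ [/(tLevE Hsyn)[a -> Oa] H]]]|[m [v [Lv H]]]].
  have Va := ok_valid Oa.
  exists m, (den c a); split.
    by apply/(Lstage_names wfE Hc); exists a => //; apply: Veq_refl.
  move=> N; have [j [[k Mk] Hk]] := H N; exists (N + j); split; first exact: leq_addr.
  split=> [|k' le]; first by exists k; apply/ME.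
  by rewrite -ME //; apply: (Hk k' (x (N + j) - k')); rewrite subnKC.
have [a Oa Ea] := (Lstage_names wfE Hc _ _).1 Lv; have Va := ok_valid Oa.
have inE k : Vin (zn k) v <-> tM y (cname a) k.
  by rewrite ME //; apply: Vin_congr => //; apply: Veq_refl.
exists m, (cname a); split; first by apply/(tLevE Hsyn); exists a.
move=> N; have [n [le [[k Hk] Hn]]] := H N; exists (n - N); rewrite subnKC //.
split=> [|k' i Ex]; first by exists k; apply/inE.
by rewrite -inE; apply: Hn; rewrite Ex leq_addr.
Qed.

(** This keeps the quantifier over tables in the definition of the set from being vacuous. The table
    is read off from actual truth and denotation. *)
Lemma table_exists x c : well_founded (Er x) -> collapses (Er x) c ->
  exists y, syntax_clauses x y /\ truth_clauses y.
Proof.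
move=> wfE Hc.
pose B j n := match j with
  | 0 => exists f, n = cfml f
  | 1 => exists m a, n = npair m (cname a) /\ ok (Er x) m a
  | 2 => exists m l, n = npair m (cnlist l) /\ okl (Er x) m l
  | 3 => exists d l i, n = npair (cname d) (npair (cnlist l) (npair i (cname (nnth d l i))))
  | 4 => exists m f d l, n = npair m (npair (cfml f) (npair (cname d) (cnlist l))) /\
           tru c m f d l
  | 5 => exists a b, n = npair (cname a) (cname b) /\ Veq (den c a) (den c b)
  | _ => exists a k, n = npair (cname a) k /\ Veq (den c a) (zn k)
  end.
pose y n : nat := `[< B (n %% 7) (n %/ 7) >].
have tabE j n : j < 7 -> tab y j n <-> B j n.
  move=> Hj; rewrite /tab /y mulnC modnMDl divnMDl // modn_small // divn_small // addn0.
  by case: asboolP.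
have F f : tF y f <-> exists g, f = cfml g by rewrite /tF tabE.
have Fn f : tF y (cfml f) by apply/F; exists f.
have Lev m a : tLev y m a <-> exists2 a', a = cname a' & ok (Er x) m a'.
  rewrite /tLev tabE //=; split=> [[m' [a' [/npair_inj[-> ->] H]]]|[a' -> H]].
    by exists a'.
  by exists m, a'.
have Lst m l : tLst y m l <-> exists2 l', l = cnlist l' & okl (Er x) m l'.
  rewrite /tLst tabE //=; split=> [[m' [a' [/npair_inj[-> ->] H]]]|[a' -> H]].
    by exists a'.
  by exists m, a'.
have N d l i a : tN y (cname d) (cnlist l) i a <-> a = cname (nnth d l i).
  rewrite /tN tabE //=; split=> [[d' [l' [i']]]|->]; last by exists d, l, i.
  by move=> /npair_inj[/cname_inj-> /npair_inj[/cnlist_inj-> /npair_inj[-> ->]]].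
have TS m f d l : tS y m (cfml f) (cname d) (cnlist l) <-> tru c m f d l.
  rewrite /tS tabE //=; split=> [[m' [f' [d' [l' [+ H]]]]]|H]; last by exists m, f, d, l.
  by move=> /npair_inj[-> /npair_inj[/cfml_inj-> /npair_inj[/cname_inj-> /cnlist_inj->]]].
have TQ a b : tQ y (cname a) (cname b) <-> Veq (den c a) (den c b).
  rewrite /tQ tabE //=; split=> [[a' [b' [/npair_inj[]]]]|H]; last by exists a, b.
  by move=> /cname_inj-> /cname_inj->.
have TZ a k : tZ y (cname a) k <-> Veq (den c a) (zn k).
  rewrite /tZ tabE //=; split=> [[a' [k' [/npair_inj[]]]]|H]; last by exists a, k.
  by move=> /cname_inj-> ->.
have Mem b a : tMem y b (cname a) <-> exists2 b', b = cname b' & mem (Er x) (tru c) b' a.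
  split=> [[p [f [l [/cname3_inj[<- <- <-] [/Lev[b' -> Ob] HS]]]]]|[b' -> [Ob HS]]].
    by exists b' => //; split=> //; apply/TS.
  exists (nlevel a), (cfml (nfml a)), (cnlist (nparams a)); split=> //.
  by split; [apply/Lev; exists b' | apply/(TS _ _ _ (ncons _ _))].
have HT := tru_clauses wfE Hc; have memc := mem_tru wfE Hc.
exists y; split; [split; [|split; [|split]]|].
- move=> f; rewrite F; split.
    move=> [[i j|i j||g h|g] ->].
    + by left; exists i, j.
    + by right; left; exists i, j.
    + by right; right; left.
    + by right; right; right; left; exists (cfml g), (cfml h).
    + by right; right; right; right; exists (cfml g).
  case=> [[i [j ->]]|[[i [j ->]]|[->|[[g [h [-> [/F[g' ->] /F[h' ->]]]]]|[g [-> /F[g' ->]]]]]]].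
  + by exists (SEq i j).
  + by exists (SIn i j).
  + by exists SBot.
  + by exists (SImp g' h').
  + by exists (SAll g').
- move=> m a; rewrite Lev; split=> [[[p f l] -> [Ep Ol]]|].
    by exists p, (cfml f), (cnlist l); do !split=> //; apply/Lst; exists l.
  move=> [p [f [l [-> [Ep [/F[f' ->] /Lst[l' -> Ol]]]]]]].
  by exists (Name p f' l').
- move=> m l; rewrite Lst; split.
    move=> [[|p f ps r] -> Ol]; [by left | right].
    exists (cname (Name p f ps)), (cnlist r); split=> //.
    case: Ol => Ep Ops Or.
    by split; [apply/Lev; exists (Name p f ps) | apply/Lst; exists r].
  move=> [->|[a [r [-> [/Lev[[p f ps] -> [Ep Ops]] /Lst[r' -> Or]]]]]].
    by exists NNil.
  by exists (NCons p f ps r').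
- move=> m _ _ i a /Lev[d -> _] /Lst[l -> _]; rewrite N.
  case: l => [|p f ps r] /=.
    by split=> [->|[[]//|[b [r [//]]]]]; left.
  split=> [->|[[]//|[b [r' [/ccons_inj[<- <-] H]]]]].
    right; exists (cname (Name p f ps)), (cnlist r); split=> //.
    by case: i => [|i]; [left | right; exists i; rewrite N].
  by case: H => [[-> ->]//|[i' [-> /N ->]]].
- split; [|split; [|split; [|split; [|split; [|split; [|split]]]]]].
  + move=> m _ _ i j /Lev[d -> Od] /Lst[l -> Ol].
    rewrite (TS _ (SEq i j)) (clEq HT) //; split=> [H|[a [b [/N-> [/N-> /TQ]]]]//].
    by exists (cname (nnth d l i)), (cname (nnth d l j)); rewrite !N TQ.
  + move=> m _ _ i j /Lev[d -> Od] /Lst[l -> Ol].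
    rewrite (TS _ (SIn i j)) (clIn HT) //; split.
      move=> [b Mb Eb]; exists (cname (nnth d l i)), (cname (nnth d l j)), (cname b).
      by rewrite !N TQ Mem; do !split=> //; exists b.
    by move=> [a [b [b' [/N-> [/N-> [/Mem[b2 -> Mb] /TQ Eb]]]]]]; exists b2.
  + move=> m _ _ /Lev[d -> Od] /Lst[l -> Ol].
    by rewrite (TS _ SBot).
  + move=> m _ _ _ _ /Lev[d -> Od] /Lst[l -> Ol] /F[f ->] /F[g ->].
    by rewrite (TS _ (SImp f g)) !TS.
  + move=> m _ _ _ /Lev[d -> Od] /Lst[l -> Ol] /F[f ->].
    rewrite (TS _ (SAll f)) (clAll HT) //; split=> H.
      by move=> _ /Lev[a -> Oa]; apply/(TS _ _ _ (ncons _ _))/H.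
    by move=> a Oa; apply/TS/H/Lev; exists a.
  + have TV a : tV y a -> exists2 a', a = cname a' & valid (Er x) a'.
      move=> [p [f [l [-> [/F[f' ->] /Lst[l' -> Ol]]]]]].
      by exists (Name p f' l').
    move=> _ _ /TV[a -> Va] /TV[b -> Vb]; rewrite TQ (clExt HT) //.
    split=> -[h1 h2]; split.
    * move=> _ /Mem[a' -> /h1[b' Mb Eb]]; exists (cname b'); rewrite TQ.
      by split=> //; apply/Mem; exists b'.
    * move=> _ /Mem[b' -> /h2[a' Ma Ea]]; exists (cname a'); rewrite TQ.
      by split=> //; apply/Mem; exists a'.
    * move=> a' Ma; have [|b' [/Mem[b2 -> Mb] /TQ]] := h1 (cname a').
        by apply/Mem; exists a'.
      by exists b2.
    * move=> b' Mb; have [|a' [/Mem[a2 -> Ma] /TQ]] := h2 (cname b').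
        by apply/Mem; exists b'.
      by exists a2.
  + move=> _ [p [f [l [-> [/F[f' ->] /Lst[l' -> Ol]]]]]].
    rewrite (TZ (Name p f' l')) Veq_zn0; split=> H.
      move=> _ /(Mem _ (Name _ _ _))[b _ Mb]; apply: (H (den c b)); apply/memc.
      by exists b => //; apply: Veq_refl.
    move=> v /memc[b Mb _]; apply: (H (cname b)); apply/(Mem _ (Name _ _ _)).
    by exists b.
  + move=> _ k [p [f [l [-> [/F[f' ->] /Lst[l' -> Ol]]]]]].
    rewrite (TZ (Name p f' l')) Veq_znS; split=> [[[v Hv Ev] H]|[[b [Hb Zb]] H]]; split.
        have [b' Mb Eb] := (memc _ _).1 Hv; exists (cname b'); split.
          by apply/(Mem _ (Name _ _ _)); exists b'.
        by apply/TZ; apply: Veq_trans (Veq_sym Eb) Ev.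
      move=> _ /(Mem _ (Name _ _ _))[b' -> Mb]; apply/TZ/H/memc.
      by exists b' => //; apply: Veq_refl.
      move: Hb Zb => /(Mem _ (Name _ _ _))[b' -> Mb] /TZ Zb.
      by exists (den c b') => //; apply/memc; exists b' => //; apply: Veq_refl.
    move=> v /memc[b' Mb Ev]; apply: Veq_trans Ev _; apply/TZ/H.
    by apply/(Mem _ (Name _ _ _)); exists b'.
Qed.

(** * The trees *)

Lemma no_descent_wf (X : Type) (E : X -> X -> Prop) :
  (forall y : nat -> X, ~ forall n, E (y n.+1) (y n)) -> well_founded E.
Proof.
move=> H a; apply: contrapT => Na.
have /choice[f Hf] b : exists b', ~ Acc E b -> E b' b /\ ~ Acc E b'.
  have [Ab|Nb] := pselect (Acc E b); first by exists b.
  apply: contrapT => Hn; apply: Nb; constructor => b' Eb'; apply: contrapT => Nb'.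
  by apply: Hn; exists b'.
apply: (H (fun n => iter n f a)) => n.
suff: ~ Acc E (iter n f a) by move=> /Hf[].
by elim: n => //= n /Hf[].
Qed.

Lemma wf_no_descent (X : Type) (E : X -> X -> Prop) (y : nat -> X) :
  well_founded E -> ~ forall n, E (y n.+1) (y n).
Proof.
move=> wfE H; suff F : forall a n, y n = a -> False by apply: (F _ 0 erefl).
elim/(well_founded_ind wfE) => b IH n En; apply: (IH (y n.+1) _ n.+1) => //.
by rewrite -En.
Qed.

(** A correct table exists, which gives the forward direction; every table satisfying the clauses is
    correct, which gives the converse. *)
Lemma matrixE x : (forall y, matrix x y) <->
  well_founded (Er x) /\ forall c, collapses (Er x) c -> Lundominated x c.
Proof.
split=> [H|[wfE H] y].
  have wfE : well_founded (Er x) by apply: no_descent_wf => y; case: (H y).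
  split=> // c Hc; have [y [Hsyn Htru]] := table_exists wfE Hc.
  by apply/(undominatedE wfE Hc Hsyn Htru); apply: (H y).2.
split=> [|[Hsyn Htru]]; first exact: wf_no_descent.
have [c Hc] := collapse_exists wfE.
by apply/(undominatedE wfE Hc Hsyn Htru)/H.
Qed.

Lemma follow (F : seq nat -> nat) : exists x, forall n, x n = F (mkseq x n).
Proof.
pose pre := fix pre n := if n is n'.+1 then rcons (pre n') (F (pre n')) else [::].
exists (fun n => F (pre n)) => n; congr F.
by elim: n => //= n {1}->; rewrite mkseqS.
Qed.

Lemma subtree_nil (T : set (seq nat)) : subtree T -> T [::].
Proof. by move=> [[s Ts] HT]; apply: HT Ts; apply: prefix0s. Qed.

Lemma finite_set_bounded (A : set nat) :
  finite_set A -> exists b, forall n, A n -> n < b.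
Proof.
move=> /finite_seqP[s ->]; exists (\max_(i <- s) i).+1 => n /= Hn.
by rewrite ltnS; apply: leq_bigmax_seq.
Qed.

Lemma infinite_set_unbounded (A : set nat) b :
  infinite_set A -> exists2 n, A n & b <= n.
Proof.
move=> infA; apply: contrapT => Hn; apply: infA.
apply: (sub_finite_set _ (finite_II b)) => n An /=.
by rewrite ltnNge; apply/negP => le; apply: Hn; exists n.
Qed.

(** The graph of [h], coded as a set of numerals, is constructible, and [Lstage_countable] preserves
    which numerals a set contains. *)
Lemma constructible_countable (VL : V_eq_L) (h : nat -> nat) :
  exists E : nat -> nat -> Prop, well_founded E /\
    forall c, collapses E c -> exists m v, Vin v (Lstage (c m)) /\
      forall n k, Vin (zn (npair n k)) v <-> k = h n.
Proof.
have [alpha [_ Hz]] := VL (VSet (fun n : nat => zn (npair n (h n)))).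
have [E [wfE HE]] := Lstage_countable Hz; exists E; split=> // c /HE[m [v [Lv Hv]]].
exists m, v; split=> // n k; rewrite Hv; split=> [[n' /zn_inj/npair_inj[-> //]]|->].
by exists n; apply: Veq_refl.
Qed.

(* The number of candidates for the first [n] values of [x] is finite, so that
   the bound does not depend on the set coded by the parities. *)
Lemma hechler_parity_branch (H : set (seq nat)) : hechler H ->
  exists h : nat -> nat, forall b : nat -> bool, exists x,
    [/\ branches H x, forall n, x n <= h n & forall n, exists k, x n = k + k + b n].
Proof.
move=> [tH fH].
have /choice[g Hg] s : exists g, H s -> forall n, g <= n -> H (rcons s n).
  have [Hs|] := pselect (H s); last by exists 0.
  have [g Hg] := finite_set_bounded (fH s Hs); exists g => _ n le.
  by apply: contrapT => /Hg; rewrite ltnNge le.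
(* The new value has parity [i] and is at least [g s], so the extension of a node stays in [H]. *)
pose ext (i : bool) s := rcons s (g s + g s + i).
pose cand := fix cand n := if n is n'.+1 then
  map (ext false) (cand n') ++ map (ext true) (cand n') else [:: [::]].
exists (fun n => \max_(s <- cand n) (g s + g s).+1) => b.
have [x Hx] := follow (fun s => g s + g s + b (size s)).
have {}Hx n : x n = g (mkseq x n) + g (mkseq x n) + b n by rewrite {1}Hx size_mkseq.
have Hc n : mkseq x n \in cand n.
  elim: n => //= n IH; rewrite mkseqS Hx mem_cat -/(ext (b n) (mkseq x n)).
  by case: (b n); rewrite map_f ?orbT.
exists x; split=> [n|n|n].
- elim: n => [|n IH]; first exact: subtree_nil.
  by rewrite mkseqS; apply: Hg => //; rewrite Hx -addnA leq_addr.
- apply: leq_trans (_ : (g (mkseq x n) + g (mkseq x n)).+1 <= _).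
    by rewrite Hx; case: (b n); rewrite ?addn1 ?addn0.
  exact: (@leq_bigmax_seq _ (cand n) predT (fun s => (g s + g s).+1)).
- by exists (g (mkseq x n)); rewrite Hx.
Qed.

Lemma laver_dominating_branch (L : set (seq nat)) (f : nat -> nat) : laver L ->
  exists2 x, branches L x & forall n, f n <= x n.
Proof.
move=> [tL iL].
have /choice[F HF] s : exists n, L s -> L (rcons s n) /\ f (size s) <= n.
  have [Ls|] := pselect (L s); last by exists 0.
  by have [n] := infinite_set_unbounded (f (size s)) (iL s Ls); exists n.
have [x Hx] := follow F.
have Lx n : L (mkseq x n).
  elim: n => [|n IH]; first exact: subtree_nil.
  by rewrite mkseqS Hx; case: (HF _ IH).
exists x => // n; have [_] := HF _ (Lx n).
by rewrite size_mkseq -Hx.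
Qed.

(* Kunen-Martin: attempts to build a branch [x] of [L] together with a descending
   sequence of [Er x]. *)
Definition attempt (L : set (seq nat)) (i j : nat) : Prop :=
  exists s p s' q, [/\ j = pickle (s : seq nat, p : nat), i = pickle (s' : seq nat, q : nat),
    L s', prefix s s' &
    [/\ size s < size s', npair q p < size s' &
    exists k, nth 0 s' (npair q p) = (k + k).+1]].

(** The sequences in an infinite descent grow to a branch [x] of [L], and the attached numbers
    descend in [Er x], because each sequence is long enough to decide the relation required of
    it. *)
Lemma attempt_wf L : subtree L ->
  (forall x, branches L x -> well_founded (Er x)) -> well_founded (attempt L).
Proof.
move=> tL wfL; apply: no_descent_wf => y Hy.
pose sp n : seq nat * nat := odflt ([::], 0) (unpickle (y n)).
have {}Hy n : [/\ L (sp n.+1).1, prefix (sp n).1 (sp n.+1).1 &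
    [/\ size (sp n).1 < size (sp n.+1).1, npair (sp n.+1).2 (sp n).2 < size (sp n.+1).1 &
    exists k, nth 0 (sp n.+1).1 (npair (sp n.+1).2 (sp n).2) = (k + k).+1]].
  have [s [p [s' [q [Ej Ei Ls pre Hs]]]]] := Hy n.
  by rewrite /sp Ej Ei !pickleK.
have pre n d : prefix (sp n).1 (sp (n + d)).1.
  elim: d => [|d IH]; first by rewrite addn0 prefix_refl.
  by rewrite addnS; apply: prefix_trans IH _; case: (Hy (n + d)).
have szs n : n <= size (sp n).1.
  by elim: n => // n IH; case: (Hy n) => _ _ [lt _ _]; apply: leq_ltn_trans IH lt.
have nthE n m i : i < size (sp n).1 -> i < size (sp m).1 ->
    nth 0 (sp n).1 i = nth 0 (sp m).1 i.
  wlog le : n m / n <= m.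
    by move=> W; case: (leqP n m) => [/W//|/ltnW/W H lt1 lt2]; rewrite H.
  move=> lt1 _; have := pre n (m - n); rewrite subnKC // => /prefixP[t ->].
  by rewrite nth_cat lt1.
(* The sequence with index [i.+1] has length at least [i.+1], so position [i] is a genuine entry. *)
pose x i := nth 0 (sp i.+1).1 i.
have xE n i : i < size (sp n).1 -> x i = nth 0 (sp n).1 i.
  by move=> lt; apply: nthE => //; apply: szs.
have Lx : branches L x.
  move=> n; have [Ls _ _] := Hy n; apply: tL.2 Ls.
  have -> : mkseq x n = take n (sp n.+1).1.
    have sz : n <= size (sp n.+1).1 by apply: ltnW; apply: szs.
    apply: (@eq_from_nth _ 0); first by rewrite size_mkseq size_takel.
    move=> i; rewrite size_mkseq => lt; rewrite nth_mkseq // nth_take //.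
    by apply: xE; apply: leq_trans lt sz.
  exact: prefix_take.
apply: (@wf_no_descent _ _ (fun n => (sp n).2) (wfL x Lx)) => n.
have [_ _ [_ lt [k Ek]]] := Hy n.
by exists k; rewrite (xE n.+1).
Qed.

(** Induction along [Er x]: each step down from [p] to [q] is matched by an attempt that extends the
    initial segment of [x]. *)
Lemma attempt_rank L x c c' : branches L x ->
  well_founded (Er x) -> collapses (Er x) c -> collapses (attempt L) c' ->
  forall p k, rle (c p) (c' (pickle (mkseq x k, p))).
Proof.
move=> Lx wfE Hc Hc'; elim/(well_founded_ind wfE) => p IH k.
apply/rleP => a /Hc[q Eqp Ea].
(* Long enough to extend [mkseq x k] properly and to include the value of [x] at [npair q p]. *)
pose k' := (maxn k (npair q p)).+1.
exists (c' (pickle (mkseq x k', q))); last exact: rle_trans (Veq_rle Ea) (IH q Eqp k').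
apply/Hc'; exists (pickle (mkseq x k', q)); last exact: Veq_refl.
have lek : k < k' by rewrite ltnS leq_maxl.
have lep : npair q p < k' by rewrite ltnS leq_maxr.
exists (mkseq x k), p, (mkseq x k'), q; split=> //.
  have -> : mkseq x k = take k (mkseq x k').
    apply: (@eq_from_nth _ 0); first by rewrite size_takel !size_mkseq // ltnW.
    move=> i; rewrite size_mkseq => lt.
    by rewrite nth_take // !nth_mkseq // (ltn_trans lt).
  exact: prefix_take.
by rewrite !size_mkseq; split=> //; rewrite nth_mkseq.
Qed.

Theorem theorem11 (VL : V_eq_L) :
  exists A : set (nat -> nat),
    [/\ lightface_Pi11 A,
        forall H : set (seq nat), hechler H -> branches H `&` A !=set0
      & ~ exists L : set (seq nat), laver L /\ branches L `<=` A].
Proof.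
exists [set x | forall y, matrix x y]; split.
- have [th Hth] := arith_matrix; exists th => x /=.
  by split=> H y; apply/(Hth x y (fun=> 0)).
- move=> H /hechler_parity_branch[h Hh].
  (* The successor makes the function exceed every [x <= h] at all arguments, whatever relation [x]
     is then made to code. *)
  have [E [wfE HE]] := constructible_countable VL (fun n => (h n).+1).
  have [x [Hx lex parx]] := Hh (fun n => `[< exists p q, n = npair p q /\ E p q >]).
  exists x; split=> //; apply/matrixE.
  have -> : Er x = E.
    apply/funext => p; apply/funext => q; apply/propext.
    rewrite /Er; have [k ->] := parx (npair p q).
    case: asboolP => /= [[p' [q' [/npair_inj[-> ->] Epq]]]|Hn]; split=> //.
    + by exists k; rewrite addn1.
    + by move=> [k']; lia.
    + by move=> Epq; case: Hn; exists p, q.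
  split=> // c /HE[m [v [Lv Hv]]]; exists m, v; split=> // N; exists N; split=> //.
  split=> [|k lek]; first by exists (h N).+1; apply/Hv.
  by move=> /Hv Ek; have := leq_trans lek (lex N); rewrite Ek ltnn.
- move=> [L [lL LA]].
  have wfL x : branches L x -> well_founded (Er x) by move=> /LA/matrixE[].
  have wfT := attempt_wf lL.1 wfL; have [c' Hc'] := collapse_exists wfT.
  have [dname dnameK] := inj_surj (Name 0 SBot NNil) cname_inj.
  (* [u (i, n)] is a value at [n] of the set whose name has code [i], or 0 if there is none:
     countably many functions, fixed before the branch is chosen. *)
  have /choice[u Hu] (i : nat * nat) : exists k,
      (exists k', Vin (zn (npair i.2 k')) (den c' (dname i.1))) ->
      Vin (zn (npair i.2 k)) (den c' (dname i.1)).
    have [[k Hk]|] := pselect (exists k', Vin (zn (npair i.2 k')) (den c' (dname i.1))).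
      by exists k.
    by exists 0.
  (* The diagonal maximum over [i <= n] bounds the function of index [i] from argument [i] on. *)
  have [x Lx domx] :=
    laver_dominating_branch (fun n => \max_(i < n.+1) u (val i, n)) lL.
  have wfE := wfL x Lx; have [c Hc] := collapse_exists wfE.
  have [_ /(_ c Hc) [m [v [Lv Hv]]]] := (matrixE x).1 (LA x Lx).
  (* The rank bound moves [v] to a level along [attempt L], where it equals one of the countably
     many named sets. *)
  have := Lstage_rle (attempt_rank Lx wfE Hc Hc' m 0) Lv.
  move=> /(Lstage_names wfT Hc')[a _ Ea].
  (* Beyond [cname a], the branch bounds the value that [u] selects, which contradicts the choice of
     [n]. *)
  have [n [len [[k Hk] Hn]]] := Hv (cname a).
  have inE j : Vin (zn (npair n j)) v <-> Vin (zn (npair n j)) (den c' (dname (cname a))).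
    by rewrite dnameK; apply: Vin_congr => //; apply: Veq_refl.
  apply: (Hn (u (cname a, n))).
    apply: leq_trans (domx n).
    exact: (@leq_bigmax _ (fun i : 'I_n.+1 => u (val i, n)) (Ordinal (len : cname a < n.+1))).
  by apply/inE; apply: (Hu (cname a, n)); exists k; apply/inE.
Qed.
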